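(* Let $T$ be an ideal-triangularizable Riesz operator on a Banach lattice $E$ with order continuous norm, and let $\mathcal A$ be any maximal set of pairwise non-equivalent atoms of $E$. Then $$\sigma(T)\setminus\{0\}=\{\varphi_a(Ta):\ a\in\mathcal A\}\setminus\{0\}$$ according to multiplicities of non-zero eigenvalues of $T$; that is, moreover, for each $\lambda\in\sigma(T)\setminus\{0\}$ the number of atoms $a\in\mathcal A$ with $\varphi_a(Ta)=\lambda$ equals the algebraic multiplicity of $\lambda$ as an eigenvalue of $T$.
   Context: Spectral notions for operators on a (real) Banach lattice are understood via the complexification. A bounded operator $T$ on a complex Banach space $X$ is a Riesz operator if its image $\pi(T)$ in the Calkin algebra $\mathcal B(X)/\mathcal K(X)$ (bounded operators modulo compact operators) is quasinilpotent, i.e. $\lim_n\|\pi(T)^n\|^{1/n}=0$; each non-zero $\lambda\in\sigma(T)$ is then an eigenvalue of finite algebraic multiplicity (the rank of the spectral projection of $T$ at $\lambda$). An operator $T$ on a Banach lattice $E$ is ideal-triangularizable if there is a chain of closed ideals of $E$, each invariant under $T$, which is maximal as a chain of closed subspaces of $E$. An atom of $E$ is a non-zero positive vector $a$ such that $0\le x,y\le a$ and $x\perp y$ imply $x=0$ or $y=0$; then the linear span of $a$ is a projection band in $E$. Two atoms are equivalent if they have the same linear span. For an atom $a$, every $x\in E$ decomposes uniquely as $x=\lambda_x a+y$ with $\lambda_x\in\mathbb R$ and $y\perp a$; the coordinate functional of $a$ is $\varphi_a(x):=\lambda_x$. The number $\varphi_a(Ta)$ is the diagonal entry of $T$ with respect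 to $a$; it does not change if $a$ is replaced by an equivalent atom. *)

(* Defs.v *)
From HB Require Import structures.
From mathcomp Require Import all_boot all_order all_algebra.
From mathcomp Require Import complex.
From mathcomp Require Import ring lra.
From mathcomp Require Import all_classical all_reals all_analysis.

Set Implicit Arguments.
Unset Strict Implicit.
Unset Printing Implicit Defensive.

Import Order.TTheory GRing.Theory Num.Theory.
Import numFieldNormedType.Exports.

Local Open Scope classical_set_scope.
Local Open Scope ring_scope.
Local Open Scope complex_scope.

(* The order is part of the mixin, and turned into an instance of the order
   hierarchy afterwards, because Hierarchy Builder rejects a structure that
   inherits from both NormedModule and Order.Lattice: it would need joins
   below Num.RealDomain. The axiom vnorm_le reads |x| <= |y| -> ||x|| <= ||y||
   where |x| is the supremum of x and - x. *)
HB.mixin Record isBanachLattice (R : realType) E & CompleteNormedModule R E := {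
  vle : rel E ;
  vsup : E -> E -> E ;
  vinf : E -> E -> E ;
  vle_refl : reflexive vle ;
  vle_anti : antisymmetric vle ;
  vle_trans : transitive vle ;
  vsup_le : forall x y z, vle (vsup x y) z = vle x z && vle y z ;
  vle_inf : forall x y z, vle x (vinf y z) = vle x y && vle x z ;
  vle_add2r : forall z x y, vle x y -> vle (x + z) (y + z) ;
  vscale_ge0 : forall (a : R) x, 0 <= a -> vle 0 x -> vle 0 (a *: x) ;
  vnorm_le : forall x y, vle (vsup x (- x)) (vsup y (- y)) -> `|x| <= `|y| ;
}.

#[short(type="banachLatticeType")]
HB.structure Definition BanachLattice (R : realType) :=
  {E of CompleteNormedModule R E & isBanachLattice R E}.

Section order_instance.
Variables (R : realType) (E : banachLatticeType R).

#[non_forgetful_inheritance]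
HB.instance Definition _ := @Order.Le_isPOrder.Build ring_display E
  (@vle R E) (@vle_refl R E) (@vle_anti R E) (@vle_trans R E).
#[non_forgetful_inheritance]
HB.instance Definition _ := @Order.POrder_isMeetSemilattice.Build ring_display E
  (@vinf R E) (@vle_inf R E).
#[non_forgetful_inheritance]
HB.instance Definition _ := @Order.POrder_isJoinSemilattice.Build ring_display E
  (@vsup R E) (@vsup_le R E).

End order_instance.

Section vector_lattice.
Variables (R : realType) (E : banachLatticeType R).
Implicit Types (x y z u : E) (a b : R).

Definition vabs x : E := Order.join x (- x).

Definition disjoint_vect x y := Order.meet (vabs x) (vabs y) = 0.

Lemma lev_D2r z x y : x <= y -> x + z <= y + z.
Proof. exact: vle_add2r. Qed.

Lemma lev_D x y z u : x <= y -> z <= u -> x + z <= y + u.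
Proof.
move=> xy zu; apply: le_trans (lev_D2r z xy) _.
by rewrite ![y + _]addrC; exact: lev_D2r.
Qed.

Lemma subv_ge0 x y : (0 <= y - x) = (x <= y).
Proof.
apply/idP/idP => [/(lev_D2r x)|/(lev_D2r (- x))]; rewrite ?add0r ?subrK//.
by rewrite subrr.
Qed.

Lemma lev_N x y : x <= y -> - y <= - x.
Proof. by rewrite -subv_ge0 -[(- y <= _)]subv_ge0 opprK addrC. Qed.

Lemma lev_Z2l a x y : 0 <= a -> x <= y -> a *: x <= a *: y.
Proof.
move=> a0; rewrite -subv_ge0 -[(a *: x <= _)]subv_ge0 -scalerBr.
exact: vscale_ge0.
Qed.

Lemma lev_Z2r x a b : 0 <= x -> a <= b -> a *: x <= b *: x.
Proof.
move=> x0; rewrite -[(a *: x <= _)]subv_ge0 -scalerBl -subr_ge0 => ab.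
exact: vscale_ge0.
Qed.

Lemma lev_vabs x : x <= vabs x. Proof. exact: leUl. Qed.

Lemma levN_vabs x : - x <= vabs x. Proof. exact: leUr. Qed.

Lemma vabs_le x y : x <= y -> - x <= y -> vabs x <= y.
Proof. by move=> xy Nxy; rewrite /vabs leUx xy. Qed.

Lemma vabs_ge0 x : 0 <= vabs x.
Proof.
have := lev_D (lev_vabs x) (levN_vabs x); rewrite subrr => h.
have h2 : 0 <= 2^-1 :> R by rewrite invr_ge0.
have := lev_Z2l h2 h.
by rewrite scaler0 -mulr2n -[vabs x *+ 2]scaler_nat scalerA mulVf ?scale1r ?pnatr_eq0.
Qed.

Lemma vabs_id x : 0 <= x -> vabs x = x.
Proof.
move=> x0; apply/le_anti; rewrite lev_vabs andbT; apply: vabs_le => //.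
by apply: le_trans (x0); have := lev_N x0; rewrite oppr0.
Qed.

Lemma lev_norm x y : vabs x <= y -> `|x| <= `|y|.
Proof.
move=> xy; apply: vnorm_le; apply: le_trans xy _.
exact: lev_vabs.
Qed.

Lemma norm_vabs x : `|vabs x| = `|x|.
Proof.
apply/le_anti; apply/andP; split; last exact: lev_norm.
by apply: vnorm_le; rewrite -[vle _ _]/(vabs (vabs x) <= vabs x) vabs_id ?vabs_ge0.
Qed.

Lemma lev_Zabs a x : a *: x <= `|a| *: vabs x.
Proof.
have [a0|a0] := ger0P a; first exact: lev_Z2l (lev_vabs _).
have -> : a *: x = (- a) *: (- x) by rewrite scalerN scaleNr opprK.
by apply: lev_Z2l (levN_vabs _); rewrite oppr_ge0 ltW.
Qed.

(* The order of a Banach lattice is closed. *)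
Lemma lev_approx x y : (forall e : R, 0 < e -> exists2 u, x <= y + u & `|u| < e) ->
  x <= y.
Proof.
move=> H; rewrite -subv_ge0.
pose p : E := Order.join (x - y) 0.
suff p0 : p = 0.
  rewrite subv_ge0 -[y]add0r -[x](subrK y); apply: lev_D2r.
  by rewrite -p0 leUl.
have pge0 : 0 <= p by exact: leUr.
apply/eqP; rewrite -normr_le0; apply/ler_addgt0Pl => e e0; rewrite addr0.
have [u xyu ue] := H e e0.
apply: le_trans (ltW ue); rewrite -[leRHS]norm_vabs; apply: lev_norm.
rewrite vabs_id// leUx vabs_ge0 andbT; apply: le_trans (lev_vabs u).
by rewrite -[u](addKr y) [- y + _]addrC; apply: lev_D2r.
Qed.

(* Completeness gives suprema to uniformly approximable families. *)
Lemma isLub_approx (A : set E) (u : E) : 0 <= u ->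
  (forall e : R, 0 < e -> exists2 s : E, lbound (ubound A) s &
     forall x, A x -> x <= s + e *: u) ->
  exists m, supremums A m.
Proof.
move=> u0 H.
have u1 : 0 < `|u| + 1 by rewrite ltr_wpDl.
have /choice[s sP] : forall n, exists s : E, lbound (ubound A) s /\
    forall x, A x -> x <= s + (n.+1%:R^-1 : R) *: u.
  by move=> n; have [|s] := H n.+1%:R^-1; [rewrite invr_gt0|exists s].
have sD m n : s m - s n <= n.+1%:R^-1 *: u.
  rewrite -[_ *: u](addKr (s n)) [- _ + _]addrC; apply: lev_D2r.
  by apply: (sP m).1 => x /(sP n).2.
have small e : 0 < e -> \forall n \near \oo, n.+1%:R^-1 * `|u| < e.
  move=> e0.
  have : (fun n => n.+1%:R^-1 * `|u|) @ \oo --> (0 : R).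
    rewrite -(mul0r `|u|); apply: cvgMr_tmp; exact: cvg_harmonic.
  by move/cvgrPdist_lt => /(_ _ e0); apply: filterS => n; rewrite sub0r normrN;
    rewrite ger0_norm// mulr_ge0.
have dist m n N : (N <= m)%N -> (N <= n)%N ->
    `|s m - s n| <= N.+1%:R^-1 * `|u|.
  move=> Nm Nn.
  have -> : N.+1%:R^-1 * `|u| = `|(N.+1%:R^-1 : R) *: u|.
    by rewrite normrZ ger0_norm.
  apply: lev_norm; apply: vabs_le.
    apply: le_trans (sD _ _) _; apply: lev_Z2r => //.
    by rewrite lef_pV2 ?posrE// ler_nat.
  rewrite opprB; apply: le_trans (sD _ _) _; apply: lev_Z2r => //.
  by rewrite lef_pV2 ?posrE// ler_nat.
have /cauchy_cvgP cs : cauchy (s @ \oo).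
  apply/cauchy_exP => e e0; have [N _ hN] := small _ e0.
  exists (s N); exists N => // n Nn /=; rewrite -ball_normE /=.
  by apply: le_lt_trans (dist _ _ N _ _) _ => //; apply: hN => /=.
pose l := lim (s @ \oo).
have near_l e : 0 < e -> \forall n \near \oo, `|l - s n| < e.
  by move=> e0; move/cvgrPdist_lt : cs; exact.
exists l; split.
  move=> x Ax; apply: lev_approx => e e0.
  have e2 : 0 < e / 2 by rewrite divr_gt0.
  near \oo => n.
  exists (s n - l + n.+1%:R^-1 *: u).
    by rewrite addrA [l + _]addrC subrK; apply: (sP n).2.
  rewrite (splitr e); apply: le_lt_trans (ler_normD _ _) _; apply: ltrD.
    by rewrite distrC; near: n; exact: near_l.
  rewrite normrZ ger0_norm//; near: n; exact: small.
move=> b Ab; apply: lev_approx => e e0.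
near \oo => n.
exists (l - s n); last by near: n; exact: near_l.
rewrite -[l in X in X <= _](subrK (s n)) [_ + s n]addrC.
by apply: lev_D2r; apply: (sP n).1.
Unshelve. all: by end_near. Qed.

Lemma finite_sup (A : set E) (x0 : E) (L : seq E) : A x0 ->
  {in L, forall x, A x} ->
  exists s, lbound (ubound A) s /\ {in L, forall x, x <= s}.
Proof.
move=> Ax0; elim: L => [_|x L IH AL].
  by exists x0; split => // b; exact.
have [|s [As Ls]] := IH; first by move=> y yL; apply: AL; rewrite inE yL orbT.
exists (Order.join x s : E); split.
  move=> b Ab; rewrite leUx As// andbT; apply: Ab; apply: AL.
  by rewrite inE eqxx.
move=> y; rewrite inE => /predU1P[->|/Ls yL]; first exact: leUl.
by apply: le_trans yL _; exact: leUr.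
Qed.

End vector_lattice.

Section modulus.
Variables (R : realType) (E : banachLatticeType R).
Implicit Types (x y : E).

Let sqr_le1 (c : R) : (c ^+ 2 <= 1) = (-1 <= c <= 1).
Proof. by rewrite -ler_norml -real_normK ?num_real// expr_le1. Qed.

Lemma cos_sin_circle (c s : R) : c ^+ 2 + s ^+ 2 = 1 ->
  exists t : R, c = cos t /\ s = sin t.
Proof.
move=> cs.
have c1 : -1 <= c <= 1 by rewrite -sqr_le1 -cs lerDl sqr_ge0.
have s2 : Num.sqrt (1 - c ^+ 2) = `|s|.
  by rewrite -cs addrAC subrr add0r sqrtr_sqr.
have [s0|s0] := ger0P s.
  by exists (acos c); rewrite acosK// sin_acos// s2 ger0_norm.
exists (- acos c); rewrite cosN sinN acosK// sin_acos// s2 ltr0_norm// opprK.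
by [].
Qed.

Lemma circle_net (e : R) : 0 < e -> exists2 L : seq (R * R),
  {in L, forall p, p.1 ^+ 2 + p.2 ^+ 2 = 1} &
  forall c s, c ^+ 2 + s ^+ 2 = 1 ->
    exists2 p, p \in L & `|c - p.1| <= e /\ `|s - p.2| <= e.
Proof.
move=> e0.
pose d := Num.min e (e ^+ 2 / 2).
have d0 : 0 < d by rewrite lt_min e0 divr_gt0 ?exprn_gt0.
have de : d <= e by rewrite /d ge_min lexx.
have de2 : d * 2 <= e ^+ 2 by rewrite -ler_pdivlMr// /d ge_min lexx orbT.
pose N := (Num.truncn d^-1).+1.
have N0 : 0 < N%:R :> R by [].
have Nd : N%:R^-1 <= d.
  by rewrite -[d]invrK lef_pV2 ?posrE ?invr_gt0// ltW// truncnS_gt.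
pose c_ (k : nat) : R := k%:R / N%:R - 1.
pose s_ k := Num.sqrt (1 - c_ k ^+ 2).
pose L1 := [seq k <- iota 0 (2 * N).+1 | c_ k ^+ 2 <= 1].
exists ([seq (c_ k, s_ k) | k <- L1] ++ [seq (c_ k, - s_ k) | k <- L1]).
  move=> p; rewrite mem_cat => /orP[] /mapP[k]; rewrite mem_filter => /andP[ck _] ->;
  by rewrite /= ?sqrrN sqr_sqrtr ?subr_ge0// addrC subrK.
move=> c s cs.
have c1 : -1 <= c <= 1 by rewrite -sqr_le1 -cs lerDl sqr_ge0.
have /andP[c1l c1r] := c1.
pose k := Num.truncn ((c + 1) * N%:R).
have cN : 0 <= (c + 1) * N%:R by rewrite mulr_ge0// -lerBlDr sub0r.
have /andP[kl kr] := truncn_itv cN.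
have ckl : c_ k <= c by rewrite /c_ lerBlDr ler_pdivrMr.
have ckr : c - c_ k <= N%:R^-1.
  suff : (c + 1) <= k.+1%:R / N%:R.
    by rewrite -natr1 mulrDl mul1r /c_; lra.
  by rewrite ler_pdivlMr// ltW.
have ck1 : -1 <= c_ k <= 1.
  by rewrite (le_trans ckl c1r) andbT /c_ lerBrDr addNr divr_ge0.
have ckL : k \in L1.
  rewrite mem_filter sqr_le1 ck1 mem_iota add0n ltnS /=.
  rewrite -(ler_nat R) (le_trans kl)// natrM ler_wpM2r//.
  lra.
have dist : `| `|s| - s_ k| <= e.
  have s0 : 0 <= `|s| by [].
  have sk0 : 0 <= s_ k by exact: sqrtr_ge0.
  have sk2 : s_ k ^+ 2 = 1 - c_ k ^+ 2 by rewrite sqr_sqrtr// subr_ge0 sqr_le1.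
  have ss2 : `|s| ^+ 2 = 1 - c ^+ 2 by rewrite real_normK ?num_real// -cs; ring.
  rewrite -ler_sqr ?nnegrE ?(ltW e0)//.
  apply: le_trans (_ : `| `|s| ^+ 2 - s_ k ^+ 2| <= _).
    rewrite subr_sqr normrM expr2 ler_wpM2l// (ger0_norm (addr_ge0 s0 sk0)).
    by rewrite ler_norml; apply/andP; split; lra.
  rewrite sk2 ss2.
  have -> : 1 - c ^+ 2 - (1 - c_ k ^+ 2) = (c_ k - c) * (c_ k + c) by ring.
  rewrite normrM distrC (ger0_norm (_ : 0 <= c - c_ k)) ?subr_ge0//.
  apply: le_trans (_ : d * 2 <= _) => //.
  apply: ler_pM => //; first by rewrite subr_ge0.
    exact: le_trans Nd.
  by rewrite ler_norml; move/andP: ck1 => [? ?]; apply/andP; split; lra.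
have cke : `|c - c_ k| <= e.
  by rewrite ger0_norm ?subr_ge0//; exact: le_trans (le_trans ckr Nd) de.
have [s0|s0] := ger0P s.
  exists (c_ k, s_ k); first by rewrite mem_cat (map_f (fun k => (c_ k, s_ k))).
  by rewrite /=; split => //; rewrite (ger0_norm s0) in dist.
exists (c_ k, - s_ k).
  by rewrite mem_cat (map_f (fun k => (c_ k, - s_ k))) ?orbT.
rewrite /=; split => //.
by rewrite (ltr0_norm s0) in dist; rewrite -normrN opprD opprK.
Qed.

(* The modulus of x + iy is the supremum of the Re (e^(-it) (x + iy)). *)
Definition modulus (z : E * E) : E :=
  get (supremums (range (fun t : R => cos t *: z.1 + sin t *: z.2))).

Let rangeE (z : E * E) : range (fun t : R => cos t *: z.1 + sin t *: z.2) =
  [set p.1 *: z.1 + p.2 *: z.2 | p in [set p : R * R | p.1 ^+ 2 + p.2 ^+ 2 = 1]].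
Proof.
apply/seteqP; split => [_ [t _ <-]|_ [[c s] /= cs <-]].
  by exists (cos t, sin t) => //=; exact: cos2Dsin2.
by have [t [-> ->]] := cos_sin_circle cs; exists t.
Qed.

Lemma modulusP (z : E * E) :
  supremums (range (fun t : R => cos t *: z.1 + sin t *: z.2)) (modulus z).
Proof.
apply: getPex; rewrite rangeE; set A := [set _ | _ in _].
pose u := vabs z.1 + vabs z.2.
have u0 : 0 <= u.
  by rewrite -[0]addr0; apply: lev_D; exact: vabs_ge0.
apply: (isLub_approx u0) => e e0.
have [L L1 Ldist] := circle_net e0.
have A1 : A z.1.
  by exists (1, 0) => /=; rewrite ?scale1r ?scale0r ?addr0// expr1n expr0n addr0.
have [|s [As Ls]] := @finite_sup R E A z.1 [seq p.1 *: z.1 + p.2 *: z.2 | p <- L] A1.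
  by move=> _ /mapP[p pL ->]; exists p => //=; exact: L1.
exists s => // _ [[c t] /= /Ldist[p pL [cp tp]] <-].
apply: le_trans (_ : (p.1 *: z.1 + p.2 *: z.2) + e *: u <= _); last first.
  by apply: lev_D2r; apply: Ls; exact: (map_f (fun p => p.1 *: z.1 + p.2 *: z.2)).
have h (a b : R) (x : E) : `|a - b| <= e -> a *: x <= b *: x + e *: vabs x.
  move=> ab; rewrite -[a in X in X <= _](subrK b) scalerDl.
  rewrite [leRHS]addrC; apply: lev_D2r.
  apply: le_trans (lev_Zabs _ _) _.
  by apply: lev_Z2r => //; exact: vabs_ge0.
by rewrite /u scalerDr addrACA; apply: lev_D; exact: h.
Qed.

Lemma modulus_ub (z : E * E) (c s : R) : c ^+ 2 + s ^+ 2 = 1 ->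
  c *: z.1 + s *: z.2 <= modulus z.
Proof.
move=> cs; have [+ _] := modulusP z; rewrite rangeE; apply.
by exists (c, s).
Qed.

Lemma modulus_least (z : E * E) (b : E) :
  (forall c s : R, c ^+ 2 + s ^+ 2 = 1 -> c *: z.1 + s *: z.2 <= b) ->
  modulus z <= b.
Proof.
move=> zb; have [_ +] := modulusP z; rewrite rangeE; apply => _ [[c s] /= cs <-].
exact: zb.
Qed.

End modulus.

(* The pair (x, y) stands for x + iy; its norm is the norm of its modulus. *)
Definition complexification (R : realType) (E : banachLatticeType R) : Type :=
  (E * E)%type.

Section complexification_theory.
Variables (R : realType) (E : banachLatticeType R).
Local Notation EC := (complexification E).
Implicit Types (z w : EC) (c : R[i]).

HB.instance Definition _ := GRing.Zmodule.copy EC (E * E)%type.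

Definition cscale c z : EC :=
  (complex.Re c *: z.1 - complex.Im c *: z.2,
   complex.Re c *: z.2 + complex.Im c *: z.1).

Let cscaleA c d z : cscale c (cscale d z) = cscale (c * d) z.
Proof.
case: c d => [a b] [a' b']; rewrite /cscale /=; congr pair.
  rewrite !(scalerBr, scalerDr) !scalerA scalerBl scalerDl !opprD.
  by rewrite -!addrA; congr (_ + _); rewrite [RHS]addrC addrA.
rewrite !(scalerBr, scalerDr) !scalerA scalerBl scalerDl.
by rewrite -!addrA; congr (_ + _); rewrite [RHS]addrC addrA.
Qed.

Let cscale1 : left_id 1 cscale.
Proof. by case=> x y; rewrite /cscale /= !scale1r !scale0r subr0 addr0. Qed.

Let cscaleDr : right_distributive cscale +%R.
Proof.
move=> c [x y] [x' y']; rewrite /cscale /=.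
by congr pair; rewrite !scalerDr ?opprD addrACA.
Qed.

Let cscaleDl z : {morph cscale^~ z : c d / c + d}.
Proof.
move=> [a b] [a' b']; rewrite /cscale /=.
by congr pair; rewrite !scalerDl ?opprD addrACA.
Qed.

HB.instance Definition _ :=
  GRing.Zmodule_isLmodule.Build R[i] EC cscaleA cscale1 cscaleDr cscaleDl.

Lemma complexificationZ c z : c *: z =
  (complex.Re c *: z.1 - complex.Im c *: z.2,
   complex.Re c *: z.2 + complex.Im c *: z.1).
Proof. by []. Qed.

Definition cnorm z : R[i] := `|modulus z|%:C.

Lemma modulus_ge0 z : 0 <= modulus z.
Proof.
apply: le_trans (vabs_ge0 z.1) _; apply: vabs_le.
  have := @modulus_ub R E z 1 0; rewrite scale1r scale0r addr0; apply.
  by rewrite expr1n expr0n addr0.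
have := @modulus_ub R E z (-1) 0; rewrite scaleN1r scale0r addr0; apply.
by rewrite sqrrN expr1n expr0n addr0.
Qed.

Lemma vabs1_modulus z : vabs z.1 <= modulus z.
Proof.
apply: vabs_le.
  have := @modulus_ub R E z 1 0; rewrite scale1r scale0r addr0; apply.
  by rewrite expr1n expr0n addr0.
have := @modulus_ub R E z (-1) 0; rewrite scaleN1r scale0r addr0; apply.
by rewrite sqrrN expr1n expr0n addr0.
Qed.

Lemma vabs2_modulus z : vabs z.2 <= modulus z.
Proof.
apply: vabs_le.
  have := @modulus_ub R E z 0 1; rewrite scale1r scale0r add0r; apply.
  by rewrite expr1n expr0n add0r.
have := @modulus_ub R E z 0 (-1); rewrite scaleN1r scale0r add0r; apply.
by rewrite sqrrN expr1n expr0n add0r.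
Qed.

Lemma modulus_le z : modulus z <= vabs z.1 + vabs z.2.
Proof.
have le1 (a b : R) : a ^+ 2 + b ^+ 2 = 1 -> `|a| <= 1.
  move=> ab; rewrite -(expr_le1 (n := 2))// real_normK ?num_real// -ab.
  by rewrite lerDl sqr_ge0.
apply: modulus_least => c s cs; apply: lev_D.
  rewrite -[leRHS]scale1r; apply: le_trans (lev_Zabs _ _) _.
  by apply: lev_Z2r (vabs_ge0 _) (le1 _ _ cs).
rewrite -[leRHS]scale1r; apply: le_trans (lev_Zabs _ _) _.
by apply: lev_Z2r (vabs_ge0 _) (le1 s c _); rewrite addrC.
Qed.

Lemma modulusD z w : modulus (z + w) <= modulus z + modulus w.
Proof.
apply: modulus_least => c s cs.
rewrite /= !scalerDr addrACA; apply: lev_D; exact: modulus_ub.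
Qed.

Let modulusZ_le c z : modulus (c *: z) <= complex.Re `|c| *: modulus z.
Proof.
case: c => a b; rewrite normc_def /=; set r := Num.sqrt _.
have r0 : 0 <= r by exact: sqrtr_ge0.
have r2 : r ^+ 2 = a ^+ 2 + b ^+ 2 by rewrite sqr_sqrtr// addr_ge0// sqr_ge0.
apply: modulus_least => c s cs; rewrite complexificationZ /=.
have -> : c *: (a *: z.1 - b *: z.2) + s *: (a *: z.2 + b *: z.1) =
    (c * a + s * b) *: z.1 + (s * a - c * b) *: z.2.
  rewrite scalerBr !scalerDr !scalerA scalerDl scalerBl -!addrA; congr (_ + _).
  by rewrite addrC -addrA [RHS]addrCA.
have [r00|rn0] := eqVneq r 0.
  have /eqP : a ^+ 2 + b ^+ 2 = 0 by rewrite -r2 r00 expr0n.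
  rewrite paddr_eq0 ?sqr_ge0// !sqrf_eq0 => /andP[/eqP -> /eqP ->].
  by rewrite r00 !mulr0 subr0 addr0 !scale0r addr0.
have -> : (c * a + s * b) *: z.1 + (s * a - c * b) *: z.2 =
   r *: (((c * a + s * b) / r) *: z.1 + ((s * a - c * b) / r) *: z.2).
  by rewrite scalerDr !scalerA !(mulrC r) !divfK.
apply: lev_Z2l => //; apply: modulus_ub.
rewrite !expr_div_n -mulrDl r2.
have -> : (c * a + s * b) ^+ 2 + (s * a - c * b) ^+ 2 =
  (c ^+ 2 + s ^+ 2) * (a ^+ 2 + b ^+ 2) by ring.
by rewrite cs mul1r divff// -r2 expf_neq0.
Qed.

Let cnorm_le (x y : E) : vabs x <= y -> `|x|%:C <= `|y|%:C.
Proof. by move=> xy; rewrite lecR; exact: lev_norm. Qed.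

Let cnormD z w : cnorm (z + w) <= cnorm z + cnorm w.
Proof.
rewrite /cnorm -rmorphD lecR; apply: le_trans (ler_normD _ _).
by apply: lev_norm; rewrite vabs_id ?modulus_ge0// modulusD.
Qed.

Let cnormZ_le c z : cnorm (c *: z) <= `|c| * cnorm z.
Proof.
have -> : `|c| = (complex.Re `|c|)%:C by rewrite RRe_real// normr_real.
rewrite /cnorm -rmorphM lecR.
have r0 : 0 <= complex.Re `|c| by case: c => a b; rewrite normc_def sqrtr_ge0.
rewrite -[X in X * _](ger0_norm r0) -normrZ.
by apply: lev_norm; rewrite vabs_id ?modulus_ge0// modulusZ_le.
Qed.

Let cnormZ c z : cnorm (c *: z) = `|c| * cnorm z.
Proof.
apply/le_anti; rewrite cnormZ_le /=.
have [->|c0] := eqVneq c 0.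
  by rewrite normr0 mul0r /cnorm lecR.
rewrite -[z in X in X <= _](scalerK c0) -ler_pdivlMl ?normr_gt0//.
by rewrite -normfV; exact: cnormZ_le.
Qed.

Let cnorm0_eq0 z : cnorm z = 0 -> z = 0.
Proof.
rewrite /cnorm => -[] /eqP; rewrite normr_eq0 => /eqP z0.
have h (x : E) : vabs x <= modulus z -> x = 0.
  rewrite z0 => x0; apply/eqP; rewrite -normr_le0 -[leRHS](normr0 E).
  exact: lev_norm.
case: z z0 h => x y z0 h.
by congr pair; apply: h; [exact: (vabs1_modulus (x, y))|exact: (vabs2_modulus (x, y))].
Qed.

HB.instance Definition _ :=
  @Lmodule_isNormed.Build R[i] EC cnorm cnormD cnormZ cnorm0_eq0.

Lemma complexification_normE z : `|z| = `|modulus z|%:C.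
Proof. by []. Qed.

Let norm_le1 z : `|z.1|%:C <= `|z|.
Proof. by rewrite complexification_normE lecR; exact/lev_norm/vabs1_modulus. Qed.

Let norm_le2 z : `|z.2|%:C <= `|z|.
Proof. by rewrite complexification_normE lecR; exact/lev_norm/vabs2_modulus. Qed.

Let norm_le z : `|z| <= (`|z.1| + `|z.2|)%:C.
Proof.
rewrite complexification_normE lecR.
rewrite -(norm_vabs z.1) -(norm_vabs z.2); apply: le_trans (ler_normD _ _).
by apply: lev_norm; rewrite vabs_id ?modulus_ge0// modulus_le.
Qed.

Let EC_complete (F : set_system EC) : ProperFilter F -> cauchy F -> cvg F.
Proof.
move=> FF Fc.
have comp (p : EC -> E) : (forall z w, p (z - w) = p z - p w) ->
    (forall z, `|p z|%:C <= `|z|) -> cvg (p @ F).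
  move=> pB ple; apply: cauchy_cvg; apply: cauchy_exP => e e0.
  have eC : 0 < e%:C :> R[i] by rewrite ltcR.
  have [z Fz] := (cauchyP F).1 Fc _ eC.
  exists (p z); suff : F (p @^-1` ball (p z) e) by [].
  apply: filterS Fz => w; rewrite -!ball_normE /= => zw.
  have := ple (z - w); rewrite pB => pzw.
  by rewrite -ltcR; exact: le_lt_trans pzw zw.
have c1 := comp fst (fun _ _ => erefl) norm_le1.
have c2 := comp snd (fun _ _ => erefl) norm_le2.
apply/cvg_ex; exists ((lim (fst @ F), lim (snd @ F)) : EC).
apply/cvgrPdist_lt => e; rewrite ltcE /= => /andP[/eqP e_im e0].
have e2 : 0 < complex.Re e / 2 by rewrite divr_gt0.
have h1 : \forall z \near F, `|lim (fst @ F) - z.1| < complex.Re e / 2.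
  by move/cvgrPdist_lt : c1 => /(_ _ e2).
have h2 : \forall z \near F, `|lim (snd @ F) - z.2| < complex.Re e / 2.
  by move/cvgrPdist_lt : c2 => /(_ _ e2).
near=> z.
apply: le_lt_trans (norm_le _) _; rewrite ltcE /= e_im eqxx /=.
rewrite [ltRHS]splitr; apply: ltrD; near: z.
  exact: h1.
exact: h2.
Unshelve. all: by end_near. Qed.

HB.instance Definition _ := Uniform_isComplete.Build EC EC_complete.

End complexification_theory.

Definition complexify (R : realType) (E : banachLatticeType R) (T : E -> E) :
  complexification E -> complexification E := fun z => (T z.1, T z.2).

Section spectral_theory.
Variables (R : realType) (X : completeNormedModType R[i]).
Implicit Types (S K U P : X -> X) (z lambda : R[i]).

Definition bounded_operator S := linear S /\ continuous S.

Definition compact_operator K :=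
  bounded_operator K /\ precompact (K @` [set x | `|x| <= 1]).

Definition operator_norm S : R :=
  sup [set complex.Re `|S x| | x in [set x : X | `|x| <= 1]].

(* The quotient norm of the class of S in the Calkin algebra. *)
Definition calkin_norm S : R :=
  inf [set operator_norm (S \- K) | K in compact_operator].

Definition riesz_operator S := bounded_operator S /\
  (fun n => calkin_norm (iter n S) `^ n%:R^-1) @ \oo --> (0 : R).

Definition bounded_inverse S U :=
  [/\ bounded_operator U, cancel S U & cancel U S].

Definition spectrum S : set R[i] :=
  [set z | ~ exists U, bounded_inverse (fun x => z *: x - S x) U].

(* Meaningful for z outside the spectrum of S only. *)
Definition resolvent S z : X -> X :=
  get [set U | bounded_inverse (fun x => z *: x - S x) U].

(* Uniform left Riemann sums suffice to integrate continuous functions, which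
   is the only case needed here. *)
Definition has_integral (f : R -> X) (a b : R) (v : X) :=
  (fun n => \sum_(k < n) ((b - a) / n%:R)%:C *: f (a + k%:R * ((b - a) / n%:R)))
    @ \oo --> v.

Definition expi (t : R) : R[i] := cos t +i* sin t.

Definition has_circle_integral (f : R[i] -> X) (c : R[i]) (r : R) (v : X) :=
  has_integral (fun t => ('i * r%:C * expi t) *: f (c + r%:C * expi t))
    0 (2 * pi) v.

(* P is the Riesz projection (2 i pi)^-1 \oint (z - S)^-1 dz along a circle
   separating lambda from the rest of the spectrum of S. *)
Definition spectral_projection S lambda P :=
  exists r : R, [/\ 0 < r,
    forall z, spectrum S z -> `|z - lambda| <= r%:C -> z = lambda &
    forall x, has_circle_integral (fun z => resolvent S z x) lambda r
                ((2 * pi)%:C * 'i *: P x)].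

Definition has_rank P (m : nat) := exists e : 'I_m -> X,
  (forall c : 'I_m -> R[i], \sum_i c i *: e i = 0 -> forall i, c i = 0) /\
  range P = [set \sum_i c i *: e i | c in [set: 'I_m -> R[i]]].

Definition algebraic_multiplicity S lambda (m : nat) :=
  exists P, spectral_projection S lambda P /\ has_rank P m.

End spectral_theory.

Section banach_lattice_notions.
Variables (R : realType) (E : banachLatticeType R).
Implicit Types (a x y : E) (V : set E) (T : E -> E).

(* Decreasing nets with infimum 0 are represented by their ranges, the
   downward directed sets with infimum 0; the norm decreases along them. *)
Definition order_continuous_norm := forall A : set E, A !=set0 ->
  (forall x y, A x -> A y -> exists z, [/\ A z, z <= x & z <= y]) ->
  infimums A 0 ->
  forall e : R, 0 < e -> exists2 x, A x & `|x| < e.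

Definition closed_subspace V :=
  [/\ V 0, forall (c : R) x y, V x -> V y -> V (c *: x + y) & closed V].

Definition closed_ideal V :=
  closed_subspace V /\ forall x y, V y -> vabs x <= vabs y -> V x.

Definition ideal_triangularizable T := exists C : set (set E),
  [/\ forall V, C V -> closed_ideal V /\ (T @` V `<=` V),
      total_on C subset &
      forall D : set (set E), C `<=` D -> D `<=` closed_subspace ->
        total_on D subset -> D `<=` C].

Definition atom a := [/\ 0 <= a, a != 0 &
  forall x y, 0 <= x <= a -> 0 <= y <= a -> disjoint_vect x y ->
    x = 0 \/ y = 0].

Definition equivalent_atoms a b :=
  [set c *: a | c in [set: R]] = [set c *: b | c in [set: R]].

Definition nonequivalent_atoms (A : set E) := A `<=` atom /\
  forall a b, A a -> A b -> equivalent_atoms a b -> a = b.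

Definition maximal_nonequivalent_atoms (A : set E) :=
  nonequivalent_atoms A /\
  forall B, nonequivalent_atoms B -> A `<=` B -> B `<=` A.

(* The unique l such that x = l a + y with y disjoint from a. *)
Definition coordinate a x : R := get [set l | disjoint_vect (x - l *: a) a].

Definition diagonal_entry T a : R := coordinate a (T a).

End banach_lattice_notions.

(* Main.v *)
From HB Require Import structures.
Require Import Defs.
From mathcomp Require Import all_boot all_order all_algebra.
From mathcomp Require Import complex.
From mathcomp Require Import ring lra.
From mathcomp Require Import all_classical all_reals all_analysis.

(** Let [S] be the complexification of [T], and let [z] be nonzero.

  For some [n >= 1], the power [S ^ n] is the sum of a compact operator and of an
  operator of norm small compared to [z ^+ n], so that the Riesz-Schauder theory
  applies to [z - S]: its powers have closed ranges, and their kernels and ranges are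
  stationary from some exponent [p] on. The space is the direct sum of the kernel
  and of the range of [(z - S) ^ p]; let [P] be the projection onto the kernel along
  the range ([riesz_proj_fun]). Either [z - S] is invertible, or [z] is an isolated
  point of the spectrum and [P] is the spectral projection. For the latter, the
  Riemann sums of the Cauchy integral, taken at the vertices of a regular polygon, are
  found to equal [r ^+ n / (r ^+ n - (S - z) ^ n)] exactly ([riesz_proj_spectral]).

  By order continuity of the norm, every closed ideal [W] of the chain is the range
  of a band projection [Q] ([band_component_pos]). The compression [S Q] inherits the
  smallness of the powers modulo compact operators, and its decomposition shows that
  [P] maps [W] to itself ([riesz_proj_invariant]).

  The jumps of the maximal chain are spanned by the atoms: the least member
  containing an atom [a] is the sum of the line of [a] and of a smaller member,
  disjoint from [a]. On this jump, [S] acts as the diagonal entry of [a], and [P] as 1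
  if this entry is [z], and as 0 otherwise ([riesz_proj_diagonal]). As in Ringrose's
  theorem on triangular compact operators, it follows that the vectors [P a], for the
  atoms [a] of [A] with diagonal entry [z], form a basis of the range of [P]. They are
  independent by triangularity ([riesz_proj_atoms_free]). They span it because
  otherwise there would be a first place of the chain where its trace on the range of
  [P] leaves their span, that place would be a jump, and the atom of this jump would
  be a counterexample ([riesz_proj_atoms_span]). Finiteness comes from the
  compactness of the unit ball of the range of [P].

  So the rank of the spectral projection is the number of atoms with diagonal entry
  [z], and [z] is in the spectrum exactly when there is such an atom. *)

Set Implicit Arguments.
Unset Strict Implicit.
Unset Printing Implicit Defensive.

Import Order.TTheory GRing.Theory Num.Theory.
Import numFieldNormedType.Exports.

Local Open Scope classical_set_scope.
Local Open Scope card_scope.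
Local Open Scope ring_scope.
Local Open Scope complex_scope.

(** * Sequences along a free ultrafilter *)

Lemma subr_subl (V : zmodType) (u x y : V) : (u - x) - (u - y) = y - x.
Proof. by rewrite opprB addrC addrA subrK. Qed.

Section iterated_linear_map.
Variables (K : pzRingType) (V : lmodType K) (f : {linear V -> V}).

Lemma iter_is_linear n : linear (iter n f).
Proof. by elim: n => // n IH a x y; rewrite !iterS IH linearP. Qed.

HB.instance Definition _ n :=
  GRing.isLinear.Build K V V *:%R (iter n f) (iter_is_linear n).

End iterated_linear_map.

Lemma ultra_fmap (T V : Type) (f : T -> V) (F : set_system T) :
  UltraFilter F -> UltraFilter (f @ F).
Proof.
move=> UF; have PF : ProperFilter F by exact: ultra_proper.
split; first exact: fmap_proper_filter.
move=> G PG FG; apply/seteqP; split => [B GB|B FB]; last exact: FG.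
have [//|nFB] := in_ultra_setVsetC (f @^-1` B) UF.
have /FG GnB : (f @ F) (~` B) by [].
have := filterI GB GnB; rewrite setICr => G0.
by case: (@filter_not_empty _ G PG); exact: G0.
Qed.

Lemma free_ultrafilter_ex :
  exists U : set_system nat, UltraFilter U /\ \oo `<=` U.
Proof. exact: ultraFilterLemma. Qed.

(** Limits along one fixed free ultrafilter replace the extraction of convergent
  subsequences: the image of a bounded sequence under a compact operator converges
  along [ufree] itself. *)
Definition ufree : set_system nat := sval (cid free_ultrafilter_ex).

Instance ufree_ultra : UltraFilter ufree.
Proof. exact: (svalP (cid free_ultrafilter_ex)).1. Qed.

Instance ufree_proper : ProperFilter ufree.
Proof. exact: ultra_proper. Qed.

Lemma ufree_eventually (P : set nat) : (\forall i \near \oo, P i) -> ufree P.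
Proof. exact: (svalP (cid free_ultrafilter_ex)).2. Qed.

Lemma ufree_gt (P : set nat) : ufree P -> forall n, exists2 i, (n < i)%N & P i.
Proof.
move=> UP n; have Un : ufree [set i | (n < i)%N].
  by apply: ufree_eventually; exists n.+1.
by have [i [ni Pi]] := filter_ex (filterI Un UP); exists i.
Qed.

Section real_norm.
Variables (R : realType) (X : normedModType R[i]).
Implicit Types (x y : X) (z w : R[i]).

(** The norm of a complex space takes its values in [R[i]], where the order is
  only partial; this is the same norm as an element of [R]. *)
Definition rnorm (V : normedZmodType R[i]) (x : V) : R := complex.Re `|x|.

Lemma rnormE (V : normedZmodType R[i]) (x : V) : `|x| = (rnorm x)%:C.
Proof. by rewrite RRe_real// normr_real. Qed.

Lemma rnorm_ge0 (V : normedZmodType R[i]) (x : V) : 0 <= rnorm x.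
Proof. by rewrite -lecR -rnormE normr_ge0. Qed.

Lemma rnorm0 (V : normedZmodType R[i]) : rnorm (0 : V) = 0.
Proof. by rewrite /rnorm normr0. Qed.

Lemma rnorm_eq0 (V : normedZmodType R[i]) (x : V) : (rnorm x == 0) = (x == 0).
Proof.
apply/eqP/eqP => [x0|->]; last exact: rnorm0.
by apply/eqP; rewrite -normr_eq0 rnormE x0.
Qed.

Lemma rnorm_gt0 (V : normedZmodType R[i]) (x : V) : (0 < rnorm x) = (x != 0).
Proof. by rewrite lt_def rnorm_ge0 andbT rnorm_eq0. Qed.

Lemma rnormD (V : normedZmodType R[i]) (x y : V) :
  rnorm (x + y) <= rnorm x + rnorm y.
Proof. by rewrite -lecR rmorphD /= -!rnormE ler_normD. Qed.

Lemma rnormN (V : normedZmodType R[i]) (x : V) : rnorm (- x) = rnorm x.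
Proof. by rewrite /rnorm normrN. Qed.

Lemma rdistC (V : normedZmodType R[i]) (x y : V) : rnorm (x - y) = rnorm (y - x).
Proof. by rewrite /rnorm distrC. Qed.

Lemma rnormB (V : normedZmodType R[i]) (x y : V) :
  rnorm (x - y) <= rnorm x + rnorm y.
Proof. by rewrite -(rnormN y) rnormD. Qed.

Lemma rdistD (V : normedZmodType R[i]) (y x z : V) :
  rnorm (x - z) <= rnorm (x - y) + rnorm (y - z).
Proof. by apply: le_trans (rnormD _ _); rewrite addrA subrK. Qed.

Lemma rnormZ z x : rnorm (z *: x) = rnorm z * rnorm x.
Proof. by apply: complexI; rewrite rmorphM /= -!rnormE normrZ. Qed.

Lemma rnormM z w : rnorm (z * w) = rnorm z * rnorm w.
Proof. by apply: complexI; rewrite rmorphM /= -!rnormE normrM. Qed.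

Lemma rnorm1 : rnorm (1 : R[i]) = 1.
Proof. by rewrite /rnorm normr1. Qed.

Lemma rnormX z n : rnorm (z ^+ n) = rnorm z ^+ n.
Proof. by elim: n => [|n IH]; rewrite ?expr0 ?rnorm1// !exprS rnormM IH. Qed.

Lemma rnormV z : rnorm z^-1 = (rnorm z)^-1.
Proof.
have [->|z0] := eqVneq z 0; first by rewrite invr0 rnorm0 invr0.
have n0 : rnorm z != 0 by rewrite rnorm_eq0.
by apply: (mulfI n0); rewrite -rnormM !divff// rnorm1.
Qed.

Lemma rnormC (a : R) : rnorm a%:C = `|a|.
Proof. by rewrite /rnorm normc_def /= expr0n addr0 sqrtr_sqr. Qed.

Lemma cvg_rnormP (T : Type) (F : set_system T) {FF : Filter F} (f : T -> X) x :
  f @ F --> x <-> forall e : R, 0 < e -> \forall t \near F, rnorm (x - f t) < e.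
Proof.
rewrite cvgrPdist_lt; split => fx e e0.
  by move: (fx e%:C); rewrite ltcR => /(_ e0); apply: filterS => t; rewrite rnormE ltcR.
have eE : e = (complex.Re e)%:C by rewrite RRe_real// gtr0_real.
rewrite eE; rewrite eE ltcR in e0.
by apply: filterS (fx _ e0) => t; rewrite rnormE ltcR.
Qed.

Lemma closure_rnormP (Y : set X) x :
  closure Y x <-> forall e : R, 0 < e -> exists2 y, Y y & rnorm (x - y) < e.
Proof.
split => [Yx e e0|Yx B].
  have /Yx[y [Yy xy]] : nbhs x (ball x (e%:C : R[i])).
    by apply: nbhsx_ballx; rewrite ltcR.
  by exists y => //; move: xy; rewrite -ball_normE /= rnormE ltcR.
rewrite -nbhs_ballE => -[e /= e0 eB].
have eE : e = (complex.Re e)%:C by rewrite RRe_real// gtr0_real.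
have [|y Yy xy] := Yx (complex.Re e); first by rewrite -ltcR -eE.
by exists y; split => //; apply: eB; rewrite -ball_normE /= rnormE eE ltcR.
Qed.

Lemma closed_rnormP (Y : set X) : closed Y <->
  forall x, (forall e : R, 0 < e -> exists2 y, Y y & rnorm (x - y) < e) -> Y x.
Proof.
split=> [cY x /closure_rnormP|Yx x /closure_rnormP]; last exact: Yx.
by rewrite -(closure_id _).1.
Qed.

Lemma closed_seq (T : Type) (F : set_system T) {FF : ProperFilter F}
    (Y : set X) (f : T -> X) x :
  closed Y -> (forall t, Y (f t)) -> f @ F --> x -> Y x.
Proof.
by move=> cY Yf; apply: closed_cvg => //; near=> t; exact: Yf.
Unshelve. all: by end_near. Qed.

End real_norm.

Section sequences_along_ufree.
Variables (R : realType) (X : completeNormedModType R[i]).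
Implicit Types (x : nat -> X) (A K : {linear X -> X}).

Definition bdd x := exists M : R, forall i, rnorm (x i) <= M.

Lemma ufree_cauchy x :
  (forall e : R, 0 < e -> exists y : X, \forall i \near ufree, rnorm (y - x i) < e) ->
  cvg (x @ ufree).
Proof.
move=> xc; apply: cauchy_cvg; apply: cauchy_exP => e e0.
have eE : e = (complex.Re e)%:C by rewrite RRe_real// gtr0_real.
have [|y xy] := xc (complex.Re e); first by rewrite -ltcR -eE.
exists y; apply: filterS xy => i.
by rewrite -ball_normE /= rnormE eE ltcR.
Qed.

Lemma lin_bounded A : continuous A ->
  exists2 M : R, 0 < M & forall v : X, rnorm (A v) <= M * rnorm v.
Proof.
move=> /linear_bounded_continuous/linear_boundedP [M [Mr AM]].
have ME : M = (complex.Re M)%:C by rewrite RRe_real.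
pose N : R := `|complex.Re M| + 1.
have N0 : 0 < N by rewrite ltr_wpDl.
have MN : M < N%:C.
  by rewrite ME ltcR; apply: le_lt_trans (ler_norm _) _; rewrite /N ltrDl.
exists N => // x; have := AM _ MN x.
by rewrite !rnormE -rmorphM /= lecR.
Qed.

Lemma bounded_lin A (M : R) :
  (forall v : X, rnorm (A v) <= M * rnorm v) -> continuous A.
Proof.
move=> AM; apply/linear_bounded_continuous/linear_boundedP.
exists (`|M|%:C); split; first by rewrite realE lecR normr_ge0.
move=> N MN x.
have NE : N = (complex.Re N)%:C.
  by rewrite RRe_real// gtr0_real// (le_lt_trans _ MN)// lecR.
rewrite NE !rnormE -rmorphM /= lecR.
apply: le_trans (AM x) _; apply: ler_wpM2r; first exact: rnorm_ge0.
by rewrite NE ltcR in MN; apply: le_trans (ler_norm M) (ltW MN).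
Qed.

Lemma cvg_lin (T : Type) (F : set_system T) {FF : Filter F} A (x : T -> X) y :
  continuous A -> x @ F --> y -> A \o x @ F --> A y.
Proof. by move=> cA xy; apply: (continuous_cvg _ (cA y)). Qed.

(** Compactness, in sequential form. *)
Definition ucompact (K : X -> X) := forall x, bdd x -> cvg (K \o x @ ufree).

(** Upper semi-Fredholm operators (closed range and finite-dimensional kernel), in
  sequential form. Compact perturbations of operators bounded below have this
  property, and it passes from a product to its right factor. *)
Definition semi_fredholm (A : X -> X) :=
  forall x, bdd x -> cvg (A \o x @ ufree) -> cvg (x @ ufree).

(** Once the sequence is scaled into the unit ball, its image under [K] sends [ufree]
  to an ultrafilter on a compact set. *)
Lemma compact_ucompact K : compact_operator K -> ucompact K.
Proof.
move=> [[_ cK]]; rewrite precompactE compact_ultra => cptK x [M xM].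
pose N : R := `|M| + 1.
have N0 : 0 < N by rewrite ltr_wpDl.
have NC : N%:C != 0 by rewrite -rnorm_eq0 rnormC normr_eq0 gt_eqF.
pose x' i : X := (N%:C)^-1 *: x i.
have Kx' : ((K \o x') @ ufree) (closure (K @` [set x | `|x| <= 1])).
  apply: (@filterS _ ufree _ setT); last exact: filterT.
  move=> i _; apply: subset_closure; exists (x' i) => //=.
  rewrite rnormE lecR /x' rnormZ rnormV rnormC gtr0_norm// mulrC ler_pdivrMr// mul1r.
  apply: le_trans (xM i) _; apply: le_trans (ler_norm _) _.
  by rewrite /N lerDl.
have UK : UltraFilter (K \o x' @ ufree) by exact: ultra_fmap.
have [y [_ y1]] := cptK _ UK Kx'.
apply/cvg_ex; exists (N%:C *: y).
have -> : K \o x = (fun i => N%:C *: (K \o x') i).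
  by apply/funext => i /=; rewrite /x' linearZ /= scalerA divff// scale1r.
exact: cvgZl_tmp.
Qed.

(** Both terms are taken close to the limit. This contradicts precompactness of a
  set that contains a separated sequence. *)
Lemma ufree_cvg_close x (e : R) : 0 < e -> cvg (x @ ufree) ->
  exists i j, (i < j)%N /\ rnorm (x i - x j) < e.
Proof.
move=> e0 /cvg_ex[l /cvg_rnormP xl].
have e2 : 0 < e / 2 by rewrite divr_gt0.
have Ue := xl _ e2.
have [i _ xi] := ufree_gt Ue 0.
have [j ij xj] := ufree_gt Ue i.
exists i, j; split => //; rewrite (splitr e).
apply: le_lt_trans (rdistD l _ _) _; apply: ltrD => //.
by rewrite rdistC.
Qed.

Lemma semi_fredholm_comp (A : X -> X) K : semi_fredholm A -> semi_fredholm K ->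
  continuous K -> semi_fredholm (A \o K).
Proof.
move=> FA FK cK x xb /FA h; apply: FK => //; apply: h.
have [N N0 KN] := lin_bounded cK; have [M xM] := xb.
exists (N * M) => i; apply: le_trans (KN _) _.
by rewrite ler_pM2l.
Qed.

End sequences_along_ufree.

(** * Riesz-Schauder theory *)

Section riesz_theory.
Variables (R : realType) (X : completeNormedModType R[i]).
Implicit Types (A K S : {linear X -> X}) (Y Z : set X) (v w x y : X).

Definition subspace_of Y := Y 0 /\ forall c x y, Y x -> Y y -> Y (c *: x + y).

Lemma sub_add Y x y : subspace_of Y -> Y x -> Y y -> Y (x + y).
Proof. by move=> [_ Y2] Yx Yy; rewrite -[x]scale1r; exact: Y2. Qed.

Lemma sub_scale Y c x : subspace_of Y -> Y x -> Y (c *: x).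
Proof. by move=> [Y0 Y2] Yx; rewrite -[_ *: _]addr0; exact: Y2. Qed.

Lemma sub_opp Y x : subspace_of Y -> Y x -> Y (- x).
Proof. by move=> sY Yx; rewrite -scaleN1r; exact: sub_scale. Qed.

Lemma sub_sub Y x y : subspace_of Y -> Y x -> Y y -> Y (x - y).
Proof. by move=> sY Yx Yy; apply: sub_add => //; exact: sub_opp. Qed.

Lemma near_min (D : set X) (d : R) : D !=set0 -> 0 < d ->
  (forall x, D x -> d <= rnorm x) ->
  exists2 x, D x & forall y, D y -> rnorm x <= 2 * rnorm y.
Proof.
move=> [x0 Dx0] d0 dD; pose B : set R := [set rnorm x | x in D].
have B0 : B !=set0 by exists (rnorm x0), x0.
have Bd : lbound B d by move=> _ [x Dx <-]; exact: dD.
have Bi : has_inf B by split => //; exists d.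
have i0 : 0 < inf B by apply: lt_le_trans d0 _; exact: lb_le_inf.
have [_ [x Dx <-] xi] := inf_adherent i0 Bi.
exists x => // y Dy; apply: le_trans (ltW xi) _.
have : inf B <= rnorm y by apply: ge_inf; [exists d|exists y].
lra.
Qed.

(** F. Riesz's lemma: subtract from [z] an almost nearest point of [Y], and
  normalize. *)
Lemma riesz_almost_orthogonal Y Z z : subspace_of Y -> closed Y ->
  subspace_of Z -> Y `<=` Z -> Z z -> ~ Y z ->
  exists v, [/\ Z v, rnorm v = 1 & forall y, Y y -> 1 / 2 <= rnorm (v - y)].
Proof.
move=> sY /closed_rnormP cY sZ YZ Zz nYz.
have [d d0 dY] : exists2 d : R, 0 < d & forall y, Y y -> d <= rnorm (z - y).
  apply: contrapT => H; apply: nYz; apply: cY => e e0.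
  apply: contrapT => He; apply: H; exists e => // y Yy.
  by rewrite leNgt; apply/negP => ye; apply: He; exists y.
have [||_ [y0 Yy0 <-] y0min] := @near_min [set z - y | y in Y] d _ d0.
- by exists (z - 0), 0 => //; exact: sY.1.
- by move=> _ [y Yy <-]; exact: dY.
set n := rnorm (z - y0) in y0min.
have n0 : 0 < n by apply: lt_le_trans d0 (dY _ _).
have nC : n%:C != 0 :> R[i] by rewrite -rnorm_eq0 rnormC normr_eq0 gt_eqF.
exists ((n%:C)^-1 *: (z - y0)); split.
- by apply: sub_scale => //; apply: sub_sub => //; exact: YZ.
- by rewrite rnormZ rnormV rnormC gtr0_norm// mulVf// gt_eqF.
move=> y Yy.
have -> : (n%:C)^-1 *: (z - y0) - y = (n%:C)^-1 *: (z - (n%:C *: y + y0)).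
  by rewrite !scalerBr scalerDr scalerA mulVf// scale1r opprD addrA addrAC.
rewrite rnormZ rnormV rnormC gtr0_norm// ler_pdivlMl//.
have : n <= 2 * rnorm (z - (n%:C *: y + y0)).
  by apply: y0min; exists (n%:C *: y + y0) => //; apply: sY.2.
lra.
Qed.

Lemma ufree_harmonic (e : R) : 0 < e -> \forall j \near ufree, j.+1%:R^-1 < e.
Proof.
move=> e0; apply: ufree_eventually.
have /cvgrPdist_lt/(_ _ e0) := @cvg_harmonic R.
by apply: filterS => j; rewrite sub0r normrN (@ger0_norm R) /harmonic/= ?invr_ge0.
Qed.

Lemma bdd_le (x : nat -> X) (M : R) : (forall i, rnorm (x i) <= M) -> bdd x.
Proof. by move=> xM; exists M. Qed.

(** If preimages could not be chosen bounded, almost minimal ones, normalized,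
  would converge to an element of the kernel, contradicting almost minimality. *)
Lemma bounded_preimages A Z : semi_fredholm A -> continuous A ->
  subspace_of Z -> closed Z ->
  exists2 c : R, 0 < c &
    forall x, Z x -> exists x', [/\ Z x', A x' = A x & rnorm x' <= c * rnorm (A x)].
Proof.
move=> FA cA sZ cZ; apply: contrapT => H.
have /choice[x xP] : forall j : nat, exists x, Z x /\
    forall x', Z x' -> A x' = A x -> j.+1%:R * rnorm (A x) < rnorm x'.
  move=> j; apply: contrapT => Hj; apply: H; exists j.+1%:R => // x Zx.
  apply: contrapT => Hx; apply: Hj; exists x; split => // x' Zx' Ax'.
  by rewrite ltNge; apply/negP => le_x'; apply: Hx; exists x'.
have Ax0 j : 0 < rnorm (A (x j)).
  rewrite rnorm_gt0; apply/eqP => Ax0; have [_ /(_ 0)] := xP j.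
  rewrite Ax0 linear0 rnorm0 mulr0 ltxx; suff: Z 0 by move=> Z0 /(_ Z0 erefl).
  exact: sZ.1.
have /choice[y yP] : forall j, exists y, [/\ Z y, A y = A (x j) &
    forall x', Z x' -> A x' = A (x j) -> rnorm y <= 2 * rnorm x'].
  move=> j; have [Zx xj] := xP j.
  have [||y [Zy Ay] ymin] :=
    @near_min [set x' | Z x' /\ A x' = A (x j)] (rnorm (A (x j))) _ (Ax0 j).
  - by exists (x j).
  - move=> x' [Zx' Ax']; apply: le_trans (ltW (xj _ Zx' Ax')).
    by rewrite ler_peMl ?rnorm_ge0// ler1n.
  by exists y; split => // x' Zx' Ax'; exact: ymin.
pose n j : R := rnorm (y j).
have yn j : j.+1%:R * rnorm (A (x j)) < n j.
  by have [Zy Ay _] := yP j; exact: (xP j).2.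
have n0 j : 0 < n j by apply: lt_trans (yn j); rewrite mulr_gt0.
have nC j : (n j)%:C != 0 :> R[i] by rewrite -rnorm_eq0 rnormC normr_eq0 gt_eqF.
pose v j := ((n j)%:C)^-1 *: y j.
have v1 j : rnorm (v j) = 1.
  by rewrite rnormZ rnormV rnormC gtr0_norm// mulVf// gt_eqF.
have Av : A \o v @ ufree --> (0 : X).
  apply/cvg_rnormP => e e0.
  apply: filterS (ufree_harmonic e0) => j /=.
  rewrite sub0r rnormN /v linearZ rnormZ rnormV rnormC.
  rewrite gtr0_norm// => je; apply: lt_trans je.
  by rewrite ltr_pdivrMl// ltr_pdivlMr// mulrC; have [_ -> _] := yP j.
have /cvg_ex[l vl] : cvg (v @ ufree).
  apply: FA; first by apply: (@bdd_le _ 1) => i; rewrite v1.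
  by apply/cvg_ex; exists 0.
have Zl : Z l.
  apply: closed_seq cZ _ vl => j; apply: sub_scale => //.
  by have [] := yP j.
have Al : A l = 0.
  apply: (@cvg_unique _ _ (A \o v @ ufree)) => //; exact: cvg_lin.
have /filter_ex[j] : \forall j \near ufree, rnorm (l - v j) < 1 / 2.
  by move/cvg_rnormP : vl; apply.
apply/negP; rewrite -leNgt.
have [Zy Ay ymin] := yP j.
have Ayl : A (y j - (n j)%:C *: l) = A (x j).
  by rewrite linearB linearZ_LR Al scaler0 subr0.
have {ymin} : n j <= 2 * rnorm (y j - (n j)%:C *: l).
  by apply: ymin => //; apply: sub_sub => //; exact: sub_scale.
have -> : l - v j = - ((n j)%:C)^-1 *: (y j - (n j)%:C *: l).
  by rewrite scaleNr scalerBr opprB scalerA mulVf// scale1r.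
rewrite rnormZ rnormN rnormV rnormC gtr0_norm// ler_pdivlMl//.
lra.
Qed.

(** Bounded preimages of a convergent sequence of the range converge along
  [ufree]. *)
Lemma closed_range A : semi_fredholm A -> continuous A -> closed (range A).
Proof.
move=> FA cA; have sT : subspace_of setT by split.
have [c c0 Ac] := bounded_preimages FA cA sT closedT.
apply/closed_rnormP => y yA.
have /choice[x xP] : forall j, exists x, [/\ rnorm (y - A x) < j.+1%:R^-1 &
    rnorm x <= c * (rnorm y + 1)].
  move=> j; have [|_ [x _ <-] yx] := yA j.+1%:R^-1; first by rewrite invr_gt0.
  have [x' [_ Ax' x'c]] := Ac x I; exists x'; rewrite Ax'; split => //.
  apply: le_trans x'c _; rewrite ler_pM2l//.
  apply: le_trans (_ : rnorm y + rnorm (y - A x) <= _).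
    by rewrite -{1}[A x](subKr y) rnormB.
  rewrite lerD2l; apply: le_trans (ltW yx) _.
  by rewrite invf_le1// ler1n.
have Ax : A \o x @ ufree --> y.
  apply/cvg_rnormP => e e0; apply: filterS (ufree_harmonic e0) => j.
  by apply: lt_trans; have [] := xP j.
have /cvg_ex[l xl] : cvg (x @ ufree).
  apply: FA; last by apply/cvg_ex; exists y.
  by apply: (@bdd_le _ (c * (rnorm y + 1))) => j; have [] := xP j.
exists l => //; apply: (@cvg_unique _ _ (A \o x @ ufree)) => //; exact: cvg_lin.
Qed.

Definition char_op (z : R[i]) S : X -> X := fun x => z *: x - S x.

Lemma char_op_is_linear (z : R[i]) S : linear (char_op z S).
Proof.
move=> a x y; rewrite /char_op linearP scalerDr scalerBr !scalerA mulrC opprD.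
by rewrite addrACA.
Qed.

HB.instance Definition _ (z : R[i]) S :=
  GRing.isLinear.Build R[i] X X *:%R (char_op z S) (char_op_is_linear z S).

Lemma char_op_continuous (z : R[i]) S : continuous S -> continuous (char_op z S).
Proof.
move=> /lin_bounded[M M0 SM]; apply: (@bounded_lin _ _ _ (rnorm z + M)) => x.
by apply: le_trans (rnormB _ _) _; rewrite rnormZ mulrDl lerD2l.
Qed.

Lemma iter_continuous A k : continuous A -> continuous (iter k A).
Proof.
move=> cA; elim: k => [|k IH] x; first exact: cvg_id.
by rewrite /= ; apply: continuous_comp; [exact: IH|exact: cA].
Qed.

(** The trace of the Riesz property at a nonzero [z]: some power of [S] is compact
  up to an error that is small compared to [z ^+ n]. With the factor [1 / 8], the
  error spoils neither the lower bound of [z ^+ n - (S ^ n - K)] nor the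
  separation of sequences obtained from F. Riesz's lemma. *)
Definition riesz_at S (z : R[i]) := z != 0 /\ exists n K, [/\ (0 < n)%N, ucompact K &
  forall x, rnorm (iter n S x - K x) <= rnorm z ^+ n / 8 * rnorm x].

Section at_a_point.
Variables (S : {linear X -> X}) (z : R[i]).
Hypotheses (cS : continuous S) (Sz : riesz_at S z).
Let L : {linear X -> X} := char_op z S.

Let LE x : L x = z *: x - S x. Proof. by []. Qed.

Let cL : continuous L. Proof. exact: char_op_continuous. Qed.

Lemma iter_char_comm k n x : iter k L (iter n S x) = iter n S (iter k L x).
Proof.
have LS y : L (S y) = S (L y).
  by rewrite !LE linearB linearZ_LR.
have LSn m y : L (iter m S y) = iter m S (L y).
  by elim: m => // m IH; rewrite iterS LS IH.
by elim: k => // k IH; rewrite !iterS IH LSn.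
Qed.

(** The operator [z ^+ n - S ^ n] is a multiple of [z - S]. *)
Lemma pow_sub_in Y n x : subspace_of Y -> (forall y, Y y -> Y (S y)) ->
  Y (L x) -> Y (z ^+ n *: x - iter n S x).
Proof.
move=> sY SY YL; elim: n => [|n IH]; first by rewrite expr0 scale1r subrr; exact: sY.1.
have -> : z ^+ n.+1 *: x - iter n.+1 S x =
    z ^+ n *: L x + S (z ^+ n *: x - iter n S x).
  rewrite LE [S (_ - _)]linearB linearZ_LR scalerBr scalerA -exprSr.
  by rewrite addrA subrK.
by apply: sY.2 => //; exact: SY.
Qed.

Lemma pow_sub_cvg n (x : nat -> X) : cvg (L \o x @ ufree) ->
  cvg ((fun i => z ^+ n *: x i - iter n S (x i)) @ ufree).
Proof.
move=> /cvg_ex[l Ll]; elim: n => [|n /cvg_ex[m IH]].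
  under eq_fun do rewrite expr0 scale1r subrr.
  exact: is_cvg_cst.
apply/cvg_ex; exists (z ^+ n *: l + S m).
have -> : (fun i => z ^+ n.+1 *: x i - iter n.+1 S (x i)) =
   (fun i => z ^+ n *: (L \o x) i) + (S \o (fun i => z ^+ n *: x i - iter n S (x i))).
  apply/funext => i; rewrite fctE /= LE [S (_ - _)]linearB linearZ_LR scalerBr scalerA -exprSr.
  by rewrite addrA subrK.
by apply: cvgD; [exact: cvgZl_tmp|exact: cvg_lin].
Qed.

(** The operator [z ^+ n - S ^ n] is semi-Fredholm, being the sum of the compact
  operator [- K] and of [z ^+ n - (S ^ n - K)], which is bounded below; and it is a
  multiple of [z - S]. *)
Lemma riesz_semi_fredholm : semi_fredholm L.
Proof.
have [z0 [n [K [_ cK SK]]]] := Sz.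
move=> x xb Lx; have /cvg_ex[m xm] := @pow_sub_cvg n _ Lx.
have /cvg_ex[k Kk] := cK _ xb.
have zn : 0 < rnorm z ^+ n by rewrite exprn_gt0// rnorm_gt0.
apply: ufree_cauchy => e e0.
have d0 : 0 < e * rnorm z ^+ n / 8 by rewrite !mulr_gt0.
move/cvg_rnormP : xm => /(_ _ d0) xm.
move/cvg_rnormP : Kk => /(_ _ d0) Kk.
have U := @filterI _ ufree (@filter_filter _ _ ufree_proper) _ _ xm Kk;
have [i [xi Ki]] := filter_ex U.
exists (x i); apply: filterS U => j [xj Kj].
set D := x i - x j.
have SD : iter n S D = iter n S (x i) - iter n S (x j) by rewrite linearB.
have KD : K D = K (x i) - K (x j) by rewrite linearB.
have E : z ^+ n *: D = (m - (z ^+ n *: x j - iter n S (x j))) -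
    (m - (z ^+ n *: x i - iter n S (x i))) + ((k - (K \o x) j) - (k - (K \o x) i)) +
    (iter n S D - K D).
  rewrite !subr_subl -addrA /=.
  have -> : z ^+ n *: x i - iter n S (x i) - (z ^+ n *: x j - iter n S (x j)) =
      z ^+ n *: D - iter n S D.
    by rewrite SD scalerBr !opprD !opprK addrACA.
  by rewrite -KD [K D + _]addrC !subrK.
have : rnorm z ^+ n * rnorm D <= 4 * (e * rnorm z ^+ n / 8) + rnorm z ^+ n / 8 * rnorm D.
  rewrite -rnormX -rnormZ E.
  apply: le_trans (rnormD _ _) _; apply: lerD; last by rewrite rnormX.
  apply: le_trans (rnormD _ _) _.
  apply: le_trans (lerD (rnormB _ _) (rnormB _ _)) _.
  by move: xi xj Ki Kj; rewrite /= rnormX; lra.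
move=> h; rewrite -(ltr_pM2l zn).
have e8 : 0 < e * rnorm z ^+ n by rewrite mulr_gt0.
have D0 : 0 <= rnorm D by exact: rnorm_ge0.
nra.
Qed.

(** The images under [K] would still be separated, by [rnorm z ^+ n / 4]. *)
Lemma separated_images_absurd (v : nat -> X) n K : (0 < n)%N -> ucompact K ->
  (forall x, rnorm (iter n S x - K x) <= rnorm z ^+ n / 8 * rnorm x) ->
  (forall i, rnorm (v i) = 1) ->
  (forall i j, (i < j)%N -> rnorm z ^+ n / 2 <= rnorm (iter n S (v i) - iter n S (v j))) ->
  False.
Proof.
move=> n0 cK SK v1 sep; have [z0 _] := Sz.
have zn : 0 < rnorm z ^+ n by rewrite exprn_gt0// rnorm_gt0.
have vb : bdd v by apply: (@bdd_le _ 1) => i; rewrite v1.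
have [|i [j [ij Kij]]] := ufree_cvg_close _ (cK _ vb) (e := rnorm z ^+ n / 4).
  by rewrite divr_gt0.
have := sep i j ij; apply/negP; rewrite -ltNge.
set D := v i - v j.
have <- : iter n S D = iter n S (v i) - iter n S (v j) by rewrite linearB.
have D2 : rnorm D <= 2 by apply: le_trans (rnormB _ _) _; rewrite !v1.
have -> : iter n S D = K D + (iter n S D - K D) by rewrite addrC subrK.
apply: le_lt_trans (rnormD _ _) _.
have := SK D; have : rnorm (K D) < rnorm z ^+ n / 4 by rewrite linearB.
have : rnorm z ^+ n / 8 * rnorm D <= rnorm z ^+ n / 8 * 2.
  by rewrite ler_pM2l// divr_gt0.
lra.
Qed.

(** Modulo [Y], the operator [S ^ n] acts on [v] as [z ^+ n]. *)
Lemma images_apart Y n v w : subspace_of Y ->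
  (forall y, Y y -> 1 / 2 <= rnorm (v - y)) ->
  Y (z ^+ n *: v - iter n S v) -> Y (iter n S w) ->
  rnorm z ^+ n / 2 <= rnorm (iter n S v - iter n S w).
Proof.
move=> sY vY Yv Yw; have [z0 _] := Sz.
have zn : z ^+ n != 0 by rewrite expf_neq0.
set u := z ^+ n *: v - iter n S v in Yv.
have -> : iter n S v - iter n S w = z ^+ n *: (v - (z ^+ n)^-1 *: (u + iter n S w)).
  rewrite scalerBr scalerA divff// scale1r opprD addrA; congr (_ - _).
  by rewrite /u subKr.
rewrite rnormZ rnormX; rewrite ler_pM2l; last by rewrite exprn_gt0// rnorm_gt0.
rewrite -[_^-1]mul1r; apply: vY; apply: sub_scale => //; exact: sub_add.
Qed.

Let sub_ker k : subspace_of [set x | iter k L x = 0].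
Proof.
split => [|c x y /= kx ky]; first by rewrite /= linear0.
by rewrite linearP /= kx ky scaler0 addr0.
Qed.

Let sub_ran k : subspace_of (range (iter k L)).
Proof.
split => [|c _ _ [x _ <-] [y _ <-]]; first by exists 0; rewrite ?linear0.
by exists (c *: x + y); rewrite ?linearP.
Qed.

Lemma char_pow_semi_fredholm k : semi_fredholm (iter k L).
Proof.
elim: k => [x _ //|k IH].
apply: (@semi_fredholm_comp _ _ L (iter k L)) => //.
  exact: riesz_semi_fredholm.
exact: iter_continuous.
Qed.

Lemma closed_ker k : closed [set x | iter k L x = 0].
Proof.
apply: (@closed_comp _ _ (iter k L) [set 0]); last first.
  by apply: accessible_closed_set1; apply: hausdorff_accessible; exact: norm_hausdorff.
by move=> x _; exact: iter_continuous.
Qed.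

Lemma closed_ran k : closed (range (iter k L)).
Proof. 
apply: (@closed_range (iter k L)); first exact: char_pow_semi_fredholm.
exact: iter_continuous.
 Qed.

Lemma ker_mono i j x : (i <= j)%N -> iter i L x = 0 -> iter j L x = 0.
Proof. by move=> /subnK <-; rewrite iterD => ->; rewrite linear0. Qed.

Lemma ran_mono i j : (i <= j)%N -> range (iter j L) `<=` range (iter i L).
Proof.
move=> ij _ [x _ <-]; exists (iter (j - i) L x) => //.
by rewrite -iterD subnKC.
Qed.

(** If the kernels of the powers of [z - S] kept growing, vectors of these kernels
  almost orthogonal to the preceding kernel would have separated images under
  [S ^ n]. *)
Lemma finite_ascent : exists p, forall x, iter p.+1 L x = 0 -> iter p L x = 0.
Proof.
apply: contrapT => H.
have /choice[v vP] : forall p, exists v, [/\ iter p.+1 L v = 0, rnorm v = 1 &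
    forall y, iter p L y = 0 -> 1 / 2 <= rnorm (v - y)].
  move=> p; have [x [xp1 xp]] : exists x, iter p.+1 L x = 0 /\ iter p L x <> 0.
    apply: contrapT => Hp; apply: H; exists p => x xp1.
    by apply: contrapT => xp; apply: Hp; exists x.
  apply: (riesz_almost_orthogonal (sub_ker p) _ (sub_ker p.+1) _ xp1 xp).
    exact: closed_ker.
  by move=> y; exact: ker_mono.
have [_ [n [K [n0 cK SK]]]] := Sz.
apply: (separated_images_absurd n0 cK SK (v := v)) => [i|i j ij].
  by have [] := vP i.
have [vi _ _] := vP i; have [vj _ vjd] := vP j.
rewrite rdistC; apply: images_apart (sub_ker j) vjd _ _.
  apply: pow_sub_in; [exact: sub_ker| |].
    by move=> y /= yj; rewrite -[S y]/(iter 1 S y) iter_char_comm yj linear0.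
  by rewrite /= -iterSr.
by rewrite /= iter_char_comm (ker_mono ij vi) linear0.
Qed.

(** The dual argument: the ranges are closed, so vectors almost orthogonal to the
  following range exist. *)
Lemma finite_descent : exists p, range (iter p L) `<=` range (iter p.+1 L).
Proof.
apply: contrapT => H.
have /choice[v vP] : forall p, exists v, [/\ range (iter p L) v, rnorm v = 1 &
    forall y, range (iter p.+1 L) y -> 1 / 2 <= rnorm (v - y)].
  move=> p; have [x [xp1 xp]] : exists x, range (iter p L) x /\ ~ range (iter p.+1 L) x.
    apply: contrapT => Hp; apply: H; exists p => x xp1.
    by apply: contrapT => xp; apply: Hp; exists x.
  apply: (riesz_almost_orthogonal (sub_ran p.+1) _ (sub_ran p) _ xp1 xp).
    exact: closed_ran.
  exact: ran_mono.
have [_ [n [K [n0 cK SK]]]] := Sz.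
apply: (separated_images_absurd n0 cK SK (v := v)) => [i|i j ij].
  by have [] := vP i.
have [[x _ vi] _ vid] := vP i; have [vj _ _] := vP j.
apply: images_apart (sub_ran i.+1) vid _ _.
  apply: pow_sub_in; [exact: sub_ran| |].
    by move=> _ [y _ <-]; exists (S y) => //; rewrite -[S y]/(iter 1 S y) iter_char_comm.
  by rewrite -vi -iterS; exists x.
have [y _ <-] := ran_mono ij vj.
by exists (iter n S y) => //; rewrite iter_char_comm.
Qed.

(** From such an exponent on, the kernels and the ranges of the powers of [z - S]
  are stationary, and the space is the direct sum of the two
  ([fitting_split], [ker_ran0]). *)
Definition fitting_exponent p :=
  (forall x, iter p.+1 L x = 0 -> iter p L x = 0) /\
  range (iter p L) `<=` range (iter p.+1 L).

Lemma fitting_exponentS p : fitting_exponent p -> fitting_exponent p.+1.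
Proof.
move=> [asc desc]; split => [x|_ [x _ <-]].
  by rewrite iterSr => /asc; rewrite -iterSr.
have [|y _ yx] := desc (iter p L x); first by exists x.
by exists y => //; rewrite iterS yx -iterS.
Qed.

Lemma fitting_exponent_le p q : (p <= q)%N -> fitting_exponent p -> fitting_exponent q.
Proof.
by move=> /subnK <- fp; elim: (q - p)%N => // k IH; rewrite addSn; exact: fitting_exponentS.
Qed.

Lemma fitting_exponent_ex : exists p, fitting_exponent p.
Proof.
have [a aP] := finite_ascent; have [d dP] := finite_descent.
have asc k : forall x, iter (k + a).+1 L x = 0 -> iter (k + a) L x = 0.
  elim: k => // k IH x; rewrite addSn iterSr => /IH; by rewrite -iterSr.
have desc k : range (iter (k + d) L) `<=` range (iter (k + d).+1 L).
  elim: k => // k IH _ [x _ <-].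
  have [|y _ yx] := IH (iter (k + d) L x); first by exists x.
  by exists y => //; rewrite addSn iterS yx -iterS.
exists (d + a)%N; split; [exact: asc|rewrite addnC; exact: desc].
Qed.

Section fitting.
Variable p : nat.
Hypothesis fp : fitting_exponent p.

Lemma ker_stable q x : iter q L x = 0 -> iter p L x = 0.
Proof.
have [qp|pq] := leqP q p; first exact: ker_mono.
have [k ->] : exists k, q = (k + p)%N by exists (q - p)%N; rewrite subnK// ltnW.
elim: k => // k IH; rewrite addSn => h; apply: IH.
by have [+ _] := fitting_exponent_le (leq_addl k p) fp; apply.
Qed.

Lemma ran_stable q : range (iter p L) `<=` range (iter q L).
Proof.
have [qp|pq] := leqP q p; first exact: ran_mono.
have [k ->] : exists k, q = (k + p)%N by exists (q - p)%N; rewrite subnK// ltnW.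
elim: k => // k IH; rewrite addSn; apply: subset_trans IH _.
by have [_] := fitting_exponent_le (leq_addl k p) fp.
Qed.

Lemma ker_ran0 x : iter p L x = 0 -> range (iter p L) x -> x = 0.
Proof. by move=> px [y _ yx]; move: px; rewrite -yx -iterD => /ker_stable. Qed.

Lemma fitting_split x : exists u, iter p L (x - iter p L u) = 0.
Proof.
have [|u _ ux] := @ran_stable (p + p)%N (iter p L x); first by exists x.
by exists u; rewrite linearB /= -iterD ux subrr.
Qed.

End fitting.

(** Fredholm alternative: an element has the same image under [(z - S) ^ p] as some
  element of the range of [z - S], and injectivity cancels the power. *)
Lemma char_op_injective_inverse : (forall x, L x = 0 -> x = 0) ->
  exists V, bounded_inverse (fun x => z *: x - S x) V.
Proof.
move=> L0; have [p fp] := fitting_exponent_ex.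
have Lp0 k x : iter k L x = 0 -> x = 0.
  by elim: k => // k IH /L0.
have /choice[V VP] : forall x, exists u, L u = x.
  move=> x; have [|u _ ux] := fp.2 (iter p L x); first by exists x.
  exists u; apply/eqP; rewrite -subr_eq0; apply/eqP; apply: (Lp0 p).
  by rewrite linearB /= -iterSr ux subrr.
have VK : cancel L V.
  by move=> x; apply/eqP; rewrite -subr_eq0; apply/eqP; apply: L0; rewrite linearB /= VP subrr.
have linV : linear V.
  by move=> a x y; rewrite -[RHS]VK linearP !VP.
pose V' : {linear X -> X} := HB.pack V (GRing.isLinear.Build _ _ _ _ _ linV).
have sT : subspace_of (setT : set X) by split.
have [c c0 Lc] := bounded_preimages riesz_semi_fredholm cL sT closedT.
exists V; split; [split => //| |] => //.
apply: (@bounded_lin _ _ V' c) => x.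
have [u [_ LuE uc]] := Lc (V x) I.
by move: uc; rewrite VP -[u]VK LuE VK.
Qed.

End at_a_point.
End riesz_theory.

(** * The spectral projection *)

Section roots_of_unity.
Variable R : realType.
Implicit Types (t : R) (n k : nat).

Lemma expi0 : expi (0 : R) = 1.
Proof. by rewrite /expi cos0 sin0. Qed.

Lemma expiD (s t : R) : expi (s + t) = expi s * expi t.
Proof.
rewrite /expi cosD sinD; apply/eqP; rewrite eq_complex /=; apply/andP.
by split; apply/eqP; ring.
Qed.

Lemma expiM k t : expi (k%:R * t) = expi t ^+ k.
Proof.
elim: k => [|k IH]; first by rewrite mul0r expi0.
by rewrite -natr1 mulrDl mul1r expiD IH exprSr.
Qed.

Lemma rnorm_expi t : rnorm (expi t) = 1.
Proof. by rewrite /rnorm normc_def /= cos2Dsin2 sqrtr1. Qed.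

Lemma expi_2pi : expi (2 * pi : R) = 1.
Proof. by rewrite mulrC mulr_natr /expi -[pi *+ 2]add0r cosD2pi sinD2pi cos0 sin0. Qed.

(** This is [cos t = 1 - 2 * sin (t / 2) ^+ 2], with [sin (t / 2) > 0]. *)
Lemma expi_neq1 t : 0 < t < 2 * pi -> expi t != 1.
Proof.
move=> /andP[t0 t2]; apply/eqP => -[+ _].
have s0 : 0 < sin (t / 2).
  apply: sin_gt0_pi; apply/andP; split; first by rewrite divr_gt0.
  by rewrite ltr_pdivrMr// mulrC.
have := cos2Dsin2 (t / 2).
rewrite {3}(splitr t) cosD -!expr2 => h1 h2.
have : 0 < sin (t / 2) ^+ 2 by rewrite exprn_gt0.
lra.
Qed.

(** A geometric sum of powers of a nontrivial root of unity. *)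
Lemma sum_expi_pow n q : (0 < q < n)%N ->
  \sum_(k < n) expi (k%:R * (2 * pi / n%:R) : R) ^+ q = 0.
Proof.
move=> /andP[q0 qn]; have n0 : 0 < n%:R :> R by rewrite ltr0n (leq_trans _ qn).
set th := 2 * pi / n%:R.
under eq_bigr => k _ do rewrite expiM exprAC.
have h : expi th ^+ q ^+ n = 1.
  rewrite exprAC -expiM /th mulrC divfK ?gt_eqF// expi_2pi expr1n //.
have := subrX1 (expi th ^+ q) n; rewrite h subrr => /esym/eqP.
rewrite mulf_eq0 subr_eq0 -expiM => /orP[|/eqP//].
suff /negbTE -> : expi (q%:R * th) != 1 by [].
have pi2 : 0 < 2 * pi :> R by rewrite mulr_gt0// pi_gt0.
apply: expi_neq1; rewrite mulr_gt0 ?ltr0n ?divr_gt0//=.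
by rewrite /th mulrA ltr_pdivrMr// mulrC ltr_pM2l// ltr_nat.
Qed.

End roots_of_unity.

Section polygon_sums.
Variables (R : realType) (X : completeNormedModType R[i]) (D : {linear X -> X}).

(** Discrete Cauchy formula. Over the vertices [w k] of a regular polygon, the mean
  of [w k / (w k - D)] is exactly [r ^+ n / (r ^+ n - D ^ n)]: multiply by
  [w k ^+ n - D ^ n], which factors through [w k - D], and note that the proper
  powers of the [w k] sum up to zero. *)
Lemma polygon_sum_resolvent (n : nat) (r : R) (x : X) (y : R[i] -> X) :
  (0 < n)%N ->
  let w k := r%:C * expi (k%:R * (2 * pi / n%:R)) in
  (forall k, w k *: y (w k) - D (y (w k)) = x) ->
  let s := (n%:R)^-1 *: \sum_(k < n) w k *: y (w k) in
  (r ^+ n)%:C *: s - iter n D s = (r ^+ n)%:C *: x.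
Proof.
move=> n0 w yx s.
have nC : n%:R != 0 :> R[i] by rewrite pnatr_eq0 -lt0n.
have tel v u m : v *: u - D u = x ->
    v ^+ m *: u - iter m D u = \sum_(j < m) v ^+ (m - j.+1) *: iter j D x.
  move=> vu; elim: m => [|m IH]; first by rewrite big_ord0 expr0 scale1r subrr.
  rewrite big_ord_recr /= subnn expr0 scale1r.
  under eq_bigr => j _ do rewrite subSS -(subnSK (ltn_ord j)) exprS -scalerA.
  have <- : v *: iter m D u - D (iter m D u) = iter m D x.
    by rewrite -[in RHS]vu [RHS]linearB linearZ_LR /= -iterS iterSr.
  by rewrite -scaler_sumr -IH scalerBr scalerA -exprS addrA subrK.
have wn k : w k ^+ n = (r ^+ n)%:C.
  rewrite exprMn -expiM mulrCA [n%:R * _]mulrC divfK ?pnatr_eq0 -?lt0n//.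
  by rewrite expiM expi_2pi expr1n mulr1 rmorphXn.
have -> : (r ^+ n)%:C *: s - iter n D s =
    (n%:R)^-1 *: \sum_(k < n) \sum_(j < n) w k ^+ (n - j) *: iter j D x.
  have -> : iter n D s = (n%:R)^-1 *: \sum_(k < n) w k *: iter n D (y (w k)).
    rewrite /s linearZ_LR; congr (_ *: _); rewrite [LHS]linear_sum.
    by apply: eq_bigr => k _; rewrite linearZ_LR.
  rewrite /s scalerA mulrC -scalerA scaler_sumr -scalerBr; congr (_ *: _).
  rewrite -sumrB; apply: eq_bigr => k _.
  rewrite scalerA mulrC -scalerA -(wn k) -scalerBr (tel _ _ _ (yx k)).
  rewrite scaler_sumr; apply: eq_bigr => j _.
  by rewrite scalerA -exprS subnSK.
rewrite exchange_big /=.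
under eq_bigr => j _ do rewrite -scaler_suml.
have wE k : w k = r%:C * expi (k%:R * (2 * pi / n%:R)) by [].
case: n n0 w yx s nC wn wE => // n _ w yx s nC wn wE.
rewrite big_ord_recl /= subn0 (eq_bigr (fun=> (r ^+ n.+1)%:C)); last first.
  by move=> k _; exact: wn.
rewrite sumr_const card_ord [X in _ + X]big1 => [|j _].
  by rewrite addr0 scalerA -[(r ^+ n.+1)%:C *+ _]mulr_natl mulrA mulVf// mul1r.
rewrite [X in X *: _](_ : _ = 0) ?scale0r//.
under eq_bigr => k _ do rewrite wE exprMn.
rewrite -mulr_sumr sum_expi_pow ?mulr0// subn_gt0 /bump /= add1n ltnS ltn_ord /=.
by rewrite subSS ltnS leq_subr.
Qed.

End polygon_sums.

Section riesz_projection.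
Variables (R : realType) (X : completeNormedModType R[i]).
Variables (S : {linear X -> X}) (z : R[i]).
Hypotheses (cS : continuous S) (Sr : forall w, w != 0 -> riesz_at S w).
Hypothesis (z0 : z != 0).
Let Sz := Sr z0.
Let L : {linear X -> X} := char_op z S.
Variable p : nat.
Hypothesis fp : fitting_exponent S z p.

Let cL : continuous L. Proof. exact: char_op_continuous. Qed.

Lemma fitting_decomposition x :
  exists y, iter p L y = 0 /\ range (iter p L) (x - y).
Proof.
have [u xu] := fitting_split fp x.
by exists (x - iter p L u); split => //; rewrite subKr; exists u.
Qed.

Definition riesz_proj_fun (x : X) : X := sval (cid (fitting_decomposition x)).

Lemma riesz_proj_ker x : iter p L (riesz_proj_fun x) = 0.
Proof. exact: (svalP (cid (fitting_decomposition x))).1. Qed.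

Lemma riesz_proj_ran x : range (iter p L) (x - riesz_proj_fun x).
Proof. exact: (svalP (cid (fitting_decomposition x))).2. Qed.

(** Since any exponent beyond [p] gives the same decomposition, the projections of
  different operators can be compared at a common exponent. *)
Lemma riesz_proj_uniq q x y : (p <= q)%N ->
  iter q L y = 0 -> range (iter q L) (x - y) -> riesz_proj_fun x = y.
Proof.
move=> pq /(ker_stable fp) y0 xy.
have {}xy := ran_mono pq xy.
apply/eqP; rewrite -subr_eq0; apply/eqP; apply: (ker_ran0 fp).
  by rewrite linearB /= riesz_proj_ker y0 subr0.
have [a _ xa] := riesz_proj_ran x; have [b _ xb] := xy.
exists (b - a) => //; rewrite linearB /= xa xb.
by rewrite subr_subl.
Qed.

Lemma riesz_proj_linear : linear riesz_proj_fun.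
Proof.
move=> a x y; apply: (@riesz_proj_uniq p) => //.
  by rewrite linearP /= !riesz_proj_ker scaler0 addr0.
have [u _ xu] := riesz_proj_ran x; have [v _ yv] := riesz_proj_ran y.
exists (a *: u + v) => //; rewrite linearP /= xu yv scalerBr opprD.
by rewrite addrACA.
Qed.

HB.instance Definition _ :=
  GRing.isLinear.Build R[i] X X *:%R riesz_proj_fun riesz_proj_linear.

Let P : {linear X -> X} := riesz_proj_fun.

(** On the range of a high power, [z - S] is injective, so that bounded preimages
  are unique. *)
Lemma bounded_below_ran k : exists2 c : R, 0 < c &
  forall x, range (iter p L) x -> rnorm x <= c * rnorm (iter k L x).
Proof.
have sR : subspace_of (range (iter p L)).
  split => [|c _ _ [x _ <-] [y _ <-]]; first by exists 0; rewrite ?linear0.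
  by exists (c *: x + y); rewrite ?linearP.
have [c c0 Lc] := bounded_preimages (A := iter k L) (@char_pow_semi_fredholm _ _ _ _ cS Sz k)
  (@iter_continuous _ _ L k cL) sR (@closed_ran _ _ _ _ cS Sz p).
exists c => // x px; have [x' [[u' _ xu'] Lx' x'c]] := Lc _ px.
suff -> : x = x' by rewrite Lx'.
have [u _ xu] := px.
apply/eqP; rewrite -subr_eq0; apply/eqP; apply: (ker_ran0 fp).
  by apply: (@ker_stable _ _ S z p fp k); rewrite linearB /= Lx' subrr.
by exists (u - u') => //; rewrite linearB /= xu xu'.
Qed.

Lemma riesz_proj_continuous : continuous P.
Proof.
have [c c0 Lc] := bounded_below_ran p.
have [M M0 LM] := lin_bounded (A := iter p L) (@iter_continuous _ _ L p cL).
apply: (@bounded_lin _ _ _ (1 + c * M)) => x.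
rewrite -{1}[P x](subKr x); apply: le_trans (rnormB _ _) _.
rewrite mulrDl mul1r lerD2l; apply: le_trans (Lc _ (riesz_proj_ran x)) _.
rewrite linearB /= riesz_proj_ker subr0 -mulrA ler_pM2l//; exact: LM.
Qed.

Lemma riesz_proj_comm x : P (L x) = L (P x).
Proof.
apply: (@riesz_proj_uniq p) => //.
  by rewrite -iterSr iterS riesz_proj_ker linear0.
have [u _ xu] := riesz_proj_ran x.
by exists (L u) => //; rewrite -iterSr iterS xu linearB.
Qed.

Lemma riesz_proj_id x : (P x = x) <-> (iter p L x = 0).
Proof.
split => [<-|px]; first exact: riesz_proj_ker.
by apply: (@riesz_proj_uniq p) => //; rewrite subrr; exists 0; rewrite ?linear0.
Qed.

Lemma range_riesz_proj : range P = [set x | iter p L x = 0].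
Proof.
apply/seteqP; split => [_ [x _ <-]|x /= /riesz_proj_id px].
  exact: riesz_proj_ker.
by exists x.
Qed.

Let char_shift w x : char_op (z + w) S x = w *: x + L x.
Proof. by rewrite /= /char_op scalerDl -addrA addrCA. Qed.

Let D : {linear X -> X} := \- L.

Let D_ker k x : iter p L x = 0 -> (p <= k)%N -> iter k D x = 0.
Proof.
move=> px pk.
have -> : iter k D x = (-1) ^+ k *: iter k L x.
  elim: k {pk} => [|k IH]; first by rewrite expr0 scale1r.
  by rewrite iterS IH /= linearZ /= -scaleN1r scalerA exprS.
by rewrite (ker_mono pk px) scaler0.
Qed.

Let D_below (c : R) k x : 0 < c ->
  (forall x, range (iter p L) x -> rnorm x <= c * rnorm (L x)) ->
  range (iter p L) x -> rnorm x <= c ^+ k * rnorm (iter k D x).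
Proof.
move=> c0 Lc; elim: k x => [|k IH] x px; first by rewrite expr0 mul1r.
rewrite iterSr exprSr -mulrA.
apply: le_trans (Lc _ px) _; rewrite mulrCA ler_pM2l//.
apply: le_trans (IH (D x) _); last first.
  have [u _ <-] := px; exists (- L u) => //.
  by rewrite linearN /= -iterSr.
by rewrite /= rnormN.
Qed.

(** The nonzero points of the disc of radius [r] around [z] are regular. If [y] is
  in the kernel of [z + w - S], its component in the kernel part vanishes because
  [z - S] is nilpotent there, and its component in the range part vanishes because
  [z - S] is bounded below by [1 / c > r] there. The second bound in the choice of
  [r] keeps [z + w] away from 0. *)
Lemma resolvent_circle : exists r c : R, [/\ 0 < r, 0 < c, r * c <= 1 / 2,
   forall x, range (iter p L) x -> rnorm x <= c * rnorm (L x) &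
   forall w, w != 0 -> rnorm w <= r ->
     exists V, bounded_inverse (fun x => (z + w) *: x - S x) V].
Proof.
have [c c0 Lc] := bounded_below_ran 1.
have zr : 0 < rnorm z by rewrite rnorm_gt0.
pose r := Num.min (1 / 2 / c) (rnorm z / 2).
have r0 : 0 < r by rewrite lt_min !divr_gt0.
have rc : r * c <= 1 / 2 by rewrite -ler_pdivlMr// /r ge_min lexx.
exists r, c; split => // w w0 wr.
have zw : z + w != 0.
  rewrite -rnorm_gt0; have := rnormB (z + w) w; rewrite addrK.
  have : r <= rnorm z / 2 by rewrite /r ge_min lexx orbT.
  lra.
apply: (char_op_injective_inverse cS (Sr zw)) => x /=; rewrite char_shift => wx.
have Lx y : w *: y + L y = 0 -> L y = - w *: y.
  by move=> /eqP; rewrite addrC addr_eq0 scaleNr => /eqP.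
have Px : P x = 0.
  have : w *: P x + L (P x) = 0 by rewrite -riesz_proj_comm -linearZ -linearD wx linear0.
  move=> /Lx LP.
  have Lk k : iter k L (P x) = (- w) ^+ k *: P x.
    elim: k => [|k IH]; first by rewrite expr0 scale1r.
    by rewrite iterS IH linearZ_LR LP scalerA exprSr.
  have := riesz_proj_ker x; rewrite -[riesz_proj_fun x]/(P x) Lk => /eqP.
  by rewrite scaler_eq0 expf_eq0 oppr_eq0 (negbTE w0) andbF /= => /eqP.
have px : range (iter p L) x.
  by have := riesz_proj_ran x; rewrite -[riesz_proj_fun x]/(P x) Px subr0.
apply/eqP; rewrite -rnorm_eq0; apply/eqP/le_anti; rewrite rnorm_ge0 andbT.
have := Lc _ px; rewrite /= -[char_op z S x]/(L x) (Lx _ wx) rnormZ rnormN mulrA.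
have : c * rnorm w * rnorm x <= 1 / 2 * rnorm x.
  apply: ler_wpM2r; first exact: rnorm_ge0.
  by apply: le_trans rc; rewrite mulrC ler_pM2r.
have := rnorm_ge0 x; lra.
Qed.

(** The Riemann sums of the resolvent along a small circle converge to the
  Riesz projection. On the kernel part, [D = S - z] is nilpotent, so the sum is the
  identity as soon as [n] reaches [p]; on the range part, [D] is bounded below by
  [1 / c] with [r * c <= 1 / 2], so the sum is of order [2 ^ (- n)]. *)
Lemma riesz_proj_spectral : spectral_projection S z P.
Proof.
have [r [c [r0 c0 rc Lc Rw]]] := resolvent_circle.
exists r; split => // [v|x].
  move=> vS vr; apply: contrapT => vz; apply: vS.
  have vzE : v = z + (v - z) by rewrite addrC subrK.
  rewrite vzE; apply: Rw; first by rewrite subr_eq0; exact/eqP.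
  by move: vr; rewrite rnormE lecR.
pose y w := resolvent S (z + w) x.
have yP w : w != 0 -> rnorm w <= r -> w *: y w + L (y w) = x.
  move=> w0 wr; rewrite -char_shift.
  have [_ _] : bounded_inverse (fun x => (z + w) *: x - S x) (resolvent S (z + w)).
    exact: (getPex (Rw w w0 wr)).
  exact.
pose w n k : R[i] := r%:C * expi (k%:R * (2 * pi / n%:R)).
pose s n := (n%:R)^-1 *: \sum_(k < n) w n k *: y (w n k).
have rw n k : rnorm (w n k) = r by rewrite rnormM rnormC rnorm_expi mulr1 gtr0_norm.
have wy n k : w n k *: y (w n k) + L (y (w n k)) = x.
  by apply: yP; rewrite -?rnorm_gt0 rw.
have sE n : (0 < n)%N -> (r ^+ n)%:C *: s n - iter n D (s n) = (r ^+ n)%:C *: x.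
  move=> n0; apply: polygon_sum_resolvent => // k.
  by rewrite opprK; apply: (wy n k).
have PD n u : P (iter n D u) = iter n D (P u).
  elim: n => // n IH; rewrite !iterS -IH.
  by rewrite /= linearN -riesz_proj_comm.
(* Applying [P] to the polygon identity isolates the kernel part. *)
have PsE n : (0 < n)%N ->
    (r ^+ n)%:C *: P (s n) - iter n D (P (s n)) = (r ^+ n)%:C *: P x.
  move=> /sE/(congr1 P); rewrite linearB PD => h.
  by rewrite -linearZ_LR h linearZ_LR.
have rn n : (r ^+ n)%:C != 0 by rewrite -rnorm_gt0 rnormC normr_gt0 expf_neq0// gt_eqF.
have Ps n : (0 < n)%N -> (p <= n)%N -> P (s n) = P x.
  move=> n0 pn; have := PsE n n0.
  rewrite D_ker ?subr0//; last exact: riesz_proj_ker.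
  exact: scalerI.
pose q : R := r * c.
have q2 n : (0 < n)%N -> q ^+ n <= 1 / 2.
  case: n => // n _; have q0 : 0 <= q by rewrite mulr_ge0 ?ltW.
  rewrite exprS -[leRHS]mulr1; apply: ler_pM => //; first by rewrite exprn_ge0.
  by rewrite exprn_ile1//; apply: le_trans rc _; lra.
have sPx n : (0 < n)%N -> (p <= n)%N -> rnorm (P x - s n) <= 2 * rnorm (x - P x) * q ^+ n.
  move=> n0 pn; rewrite rdistC -{1}(Ps n n0 pn).
  set m := s n - P (s n).
  have mR : range (iter p L) m by exact: riesz_proj_ran.
  have mE : iter n D m = (r ^+ n)%:C *: (m - (x - P x)).
    have h := sE n n0; have h2 := PsE n n0.
    have -> : iter n D m = iter n D (s n) - iter n D (P (s n)) by rewrite linearB.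
    have h' u v : (r ^+ n)%:C *: u - iter n D u = (r ^+ n)%:C *: v ->
        iter n D u = (r ^+ n)%:C *: (u - v) by rewrite scalerBr => <-; rewrite subKr.
    rewrite (h' _ _ h) (h' _ _ h2) -scalerBr; congr (_ *: _).
    by rewrite /m !opprD !opprK addrACA.
  have := D_below n c0 Lc mR; rewrite mE rnormZ rnormC ger0_norm ?exprn_ge0 ?(ltW r0)//.
  rewrite mulrA -exprMn [c * r]mulrC -/q => mq.
  have qn0 : 0 <= q ^+ n by rewrite exprn_ge0// mulr_ge0 ?ltW.
  have h3 : rnorm (m - (x - P x)) <= rnorm m + rnorm (x - P x) by exact: rnormB.
  have := ler_wpM2l qn0 h3.
  have := ler_wpM2r (rnorm_ge0 m) (q2 n n0).
  move: mq; move: (rnorm (m - _)) (rnorm (x - _)) (rnorm m) => a b d.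
  rewrite mulrDr; lra.
have sP : s @ \oo --> P x.
  apply/cvg_rnormP => e e0.
  have q0 : 0 <= q by rewrite mulr_ge0 ?ltW.
  have q1 : `|q| < 1 by rewrite ger0_norm // /q; apply: le_lt_trans rc _; lra.
  have : (fun n => 2 * rnorm (x - P x) * q ^+ n) @ \oo --> (2 * rnorm (x - P x) * 0 : R).
    by apply: cvgMl_tmp; exact: cvg_expr.
  rewrite mulr0 => /cvgrPdist_lt/(_ _ e0) h.
  near=> n; have n0 : (0 < n)%N by near: n; exists 1%N.
  apply: le_lt_trans (sPx n n0 _) _; first by near: n; exists p.
  apply: le_lt_trans (ler_norm _) _; rewrite -normrN -[- _]sub0r.
  by near: n.
rewrite /has_circle_integral /has_integral.
have -> : (fun n => \sum_(k < n) ((2 * pi - 0) / n%:R)%:C *: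
    ((('i * r%:C * expi (0 + k%:R * ((2 * pi - 0) / n%:R))) *:
      resolvent S (z + r%:C * expi (0 + k%:R * ((2 * pi - 0) / n%:R))) x))) =
  (fun n => ((2 * pi)%:C * 'i) *: s n).
  apply/funext => n; rewrite /s scaler_sumr scaler_sumr; apply: eq_bigr => k _.
  rewrite !add0r subr0 -/(w n k) -/(y (w n k)) !scalerA.
  congr (_ *: _); rewrite rmorphM /= fmorphV /= rmorph_nat /w; ring.
exact: cvgZl_tmp.
Unshelve. all: by end_near. Qed.

End riesz_projection.

(** * Riesz operators, finite spans and invariant subspaces *)

Section from_calkin_norm.
Variables (R : realType) (X : completeNormedModType R[i]).
Implicit Types (A S K : {linear X -> X}).

Lemma operator_normP A (x : X) : continuous A ->
  rnorm (A x) <= operator_norm A * rnorm x.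
Proof.
move=> /lin_bounded[M M0 AM].
have [->|x0] := eqVneq x 0; first by rewrite linear0 !rnorm0 mulr0.
have n0 : 0 < rnorm x by rewrite rnorm_gt0.
have nC : (rnorm x)%:C != 0 :> R[i] by rewrite -rnorm_eq0 rnormC normr_eq0 gt_eqF.
rewrite -ler_pdivrMr// mulrC.
have -> : (rnorm x)^-1 * rnorm (A x) = rnorm (A (((rnorm x)%:C)^-1 *: x)).
  by rewrite linearZ_LR rnormZ rnormV rnormC gtr0_norm.
apply: ub_le_sup; last first.
  exists (((rnorm x)%:C)^-1 *: x) => //=.
  by rewrite rnormE lecR rnormZ rnormV rnormC gtr0_norm// mulVf// gt_eqF.
exists M => _ [y /= y1 <-]; apply: le_trans (AM y) _.
by rewrite -[leRHS]mulr1 ler_pM2l//; move: y1; rewrite rnormE lecR.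
Qed.

Lemma compact_operator0 : compact_operator (fun=> 0 : X).
Proof.
split; first split.
- by move=> c x y /=; rewrite scaler0 addr0.
- by move=> x; exact: cvg_cst.
apply: (@precompact_subset _ _ [set 0]) => [_ [x _ <-]//|].
by apply: compact_precompact; [exact: norm_hausdorff|exact: compact_set1].
Qed.

(** The root test provides a power [n >= 1] whose distance to the compact operators
  is below [(rnorm w / 8) ^+ n], hence below [rnorm w ^+ n / 8]. *)
Lemma riesz_operator_riesz_at S (w : R[i]) : riesz_operator S -> w != 0 -> riesz_at S w.
Proof.
move=> [[_ cS] Sc] w0; split => //.
have e0 : 0 < rnorm w / 8 by rewrite divr_gt0// rnorm_gt0.
have [n n0 cn] : exists2 n, (0 < n)%N & calkin_norm (iter n S) < (rnorm w / 8) ^+ n.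
  move/cvgrPdist_lt : Sc => /(_ _ e0) Sc.
  near \oo => n; have n0 : (0 < n)%N by near: n; exists 1%N.
  exists n => //; have : `|0 - calkin_norm (iter n S) `^ n%:R^-1| < rnorm w / 8.
    by near: n.
  rewrite sub0r normrN (ger0_norm (powR_ge0 _ _)) => h.
  have [c0|c0] := leP 0 (calkin_norm (iter n S)); last first.
    by apply: lt_le_trans c0 _; rewrite exprn_ge0// ltW.
  have -> : calkin_norm (iter n S) = (calkin_norm (iter n S) `^ n%:R^-1) ^+ n.
    by rewrite -powR_mulrn ?powR_ge0// -powRrM mulVf ?powRr1// pnatr_eq0 -lt0n.
  by rewrite ltrXn2r// -?lt0n// powR_ge0.
have [|_ [K Kc <-] SK] := inf_lt _ cn.
  by exists (operator_norm (iter n S \- (fun=> 0))), (fun=> 0) => //; exact: compact_operator0.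
pose K' : {linear X -> X} := HB.pack K (GRing.isLinear.Build _ _ _ _ _ Kc.1.1).
exists n, K'; split => //; first exact: compact_ucompact.
move=> x; have cSK : continuous (iter n S \- K').
  by move=> y; apply: continuousB; [exact: iter_continuous|exact: Kc.1.2].
apply: le_trans (operator_normP x cSK) _; apply: ler_wpM2r; first exact: rnorm_ge0.
apply: ltW; apply: lt_le_trans SK _.
rewrite expr_div_n ler_pM2l ?exprn_gt0 ?rnorm_gt0// lef_pV2 ?posrE ?exprn_gt0//.
by case: n n0 {cn cSK} => // n _; rewrite exprS ler_peMr// exprn_ege1// ler1n.
Unshelve. all: by end_near. Qed.

End from_calkin_norm.

Section finite_span.
Variables (R : realType) (X : completeNormedModType R[i]).
Implicit Types (Y : set X) (x y z : X) (c : R[i]).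

Definition add_line Y z : set X := [set x | exists c, Y (x - c *: z)].

Lemma add_line_subspace Y z : subspace_of Y -> subspace_of (add_line Y z).
Proof.
move=> sY; split; first by exists 0; rewrite scale0r subrr; exact: sY.1.
move=> a x y [c xc] [d yd]; exists (a * c + d).
have -> : a *: x + y - (a * c + d) *: z = a *: (x - c *: z) + (y - d *: z).
  by rewrite scalerDl scalerBr scalerA opprD addrACA.
exact: sY.2.
Qed.

Lemma ufree_cvg_real (t : nat -> R) (M : R) : (forall i, `|t i| <= M) ->
  cvg (t @ ufree).
Proof.
move=> tM; have := @segment_compact R (- M) M; rewrite compact_ultra.
move=> /(_ (t @ ufree) (ultra_fmap t ufree_ultra)) [].
  apply: (@filterS _ ufree _ setT); last exact: filterT.
  by move=> i _ /=; rewrite in_itv /= -ler_norml.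
by move=> l [_ tl]; apply/cvg_ex; exists l.
Qed.

(** When [z] is not in [Y], the coefficient along [z] is bounded by the norm over
  the distance from [z] to [Y], so that coefficients of approximations converge
  along [ufree]. *)
Lemma add_line_closed Y z : subspace_of Y -> closed Y -> closed (add_line Y z).
Proof.
move=> sY cY; have [Yz|nYz] := pselect (Y z).
  suff -> : add_line Y z = Y by [].
  apply/seteqP; split => [x [c xc]|x Yx]; last by exists 0; rewrite scale0r subr0.
  by rewrite -(subrK (c *: z) x); apply: sub_add => //; exact: sub_scale.
have [d d0 dY] : exists2 d : R, 0 < d & forall y, Y y -> d <= rnorm (z - y).
  apply: contrapT => H; apply: nYz; move/closed_rnormP: cY; apply => e e0.
  apply: contrapT => He; apply: H; exists e => // y Yy.
  by rewrite leNgt; apply/negP => ye; apply: He; exists y.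
have cd c y : Y y -> rnorm c * d <= rnorm (y + c *: z).
  move=> Yy; have [->|c0] := eqVneq c 0; first by rewrite rnorm0 mul0r rnorm_ge0.
  have -> : y + c *: z = c *: (z - - c^-1 *: y).
    by rewrite scaleNr opprK scalerDr scalerA divff// scale1r addrC.
  rewrite rnormZ ler_pM2l ?rnorm_gt0//; apply: dY; exact: sub_scale.
apply/closed_rnormP => x xY.
have /choice[u uP] : forall j : nat, exists u : X * R[i],
    Y (u.1 - u.2 *: z) /\ rnorm (x - u.1) < j.+1%:R^-1.
  move=> j; have [|v [c vc] xv] := xY j.+1%:R^-1; first by rewrite invr_gt0.
  by exists (v, c).
have ux : (fun j => (u j).1) @ ufree --> x.
  apply/cvg_rnormP => e e0; apply: filterS (ufree_harmonic e0) => j.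
  by apply: lt_trans; have [] := uP j.
pose M := (rnorm x + 1) / d.
have cM j : rnorm (u j).2 <= M.
  rewrite ler_pdivlMr//; have [Yu xu] := uP j; apply: le_trans (cd _ _ Yu) _.
  rewrite subrK; apply: le_trans (_ : rnorm x + rnorm (x - (u j).1) <= _).
    by rewrite -{1}[(u j).1](subKr x) rnormB.
  rewrite lerD2l; apply: le_trans (ltW xu) _.
  by rewrite invf_le1// ler1n.
have reM (c : R[i]) : `|complex.Re c| <= rnorm c.
  case: c => a b; rewrite /rnorm normc_def /= -sqrtr_sqr; apply: ler_wsqrtr.
  by rewrite lerDl sqr_ge0.
have imM (c : R[i]) : `|complex.Im c| <= rnorm c.
  case: c => a b; rewrite /rnorm normc_def /= -sqrtr_sqr; apply: ler_wsqrtr.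
  by rewrite lerDr sqr_ge0.
have /cvg_ex[a ca] := ufree_cvg_real (fun j => le_trans (reM _) (cM j)).
have /cvg_ex[b cb] := ufree_cvg_real (fun j => le_trans (imM _) (cM j)).
exists (a +i* b).
apply: (closed_seq (F := ufree) cY (fun j => (uP j).1)) => /=.
suff uz : (fun j => (u j).2 *: z) @ ufree --> (a +i* b) *: z.
  exact: cvgB ux uz.
apply/cvg_rnormP => e e0.
pose n := rnorm z + 1; have n0 : 0 < n by rewrite ltr_wpDl// rnorm_ge0.
have e2 : 0 < e / 2 / n by rewrite !divr_gt0.
move/cvgrPdist_lt : ca => /(_ _ e2) ca; move/cvgrPdist_lt : cb => /(_ _ e2) cb.
near=> j; rewrite -scalerBl rnormZ.
have : rnorm ((a +i* b) - (u j).2) < e / n.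
  have -> : (a +i* b) - (u j).2 =
      (a - complex.Re (u j).2)%:C + 'i * (b - complex.Im (u j).2)%:C.
    by case: (u j).2 => p q; apply/eqP; rewrite eq_complex /=; apply/andP; split; apply/eqP; ring.
  apply: le_lt_trans (rnormD _ _) _.
  rewrite rnormM (_ : rnorm 'i = 1) ?mul1r; last first.
    by rewrite /rnorm normc_def /= expr0n expr1n add0r sqrtr1.
  rewrite !rnormC (_ : e / n = e / 2 / n + e / 2 / n); last first.
    by rewrite -mulrDl -splitr.
  by apply: ltrD; near: j.
have z0 := rnorm_ge0 z; move=> h; apply: le_lt_trans (_ : e / n * rnorm z < _).
  by apply: ler_wpM2r => //; exact: ltW.
rewrite mulrAC ltr_pdivrMr// /n mulrDr mulr1 ltrDl.
Unshelve. all: by end_near. Qed.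

Definition span_below (e : nat -> X) k : set X :=
  [set x | exists c : nat -> R[i], x = \sum_(i < k) c i *: e i].

Lemma span_belowS e k : span_below e k.+1 = add_line (span_below e k) (e k).
Proof.
apply/seteqP; split => [x [c ->]|x [d [c xd]]].
  by exists (c k), c; rewrite big_ord_recr /= addrK.
exists (fun i => if (i < k)%N then c i else d).
rewrite big_ord_recr /= ltnn -[x](subrK (d *: e k)) xd; congr (_ + _).
by apply: eq_bigr => i _; rewrite ltn_ord.
Qed.

Lemma span_below_closed_subspace e k :
  subspace_of (span_below e k) /\ closed (span_below e k).
Proof.
elim: k => [|k [sY cY]]; last first.
  by rewrite span_belowS; split; [exact: add_line_subspace|exact: add_line_closed].
have -> : span_below e 0 = [set 0].
  apply/seteqP; split => [x [c ->]|_ ->]; first by rewrite big_ord0.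
  by exists (fun=> 0); rewrite big_ord0.
split; first by split => // c x y -> ->; rewrite scaler0 addr0.
by apply: accessible_closed_set1; apply: hausdorff_accessible; exact: norm_hausdorff.
Qed.

Lemma span_below_mem e k i : (i < k)%N -> span_below e k (e i).
Proof.
move=> ik; exists (fun j => (j == i)%:R).
rewrite (bigD1 (Ordinal ik)) //= eqxx scale1r big1 ?addr0// => j.
rewrite -val_eqE /= => /negbTE ->; exact: scale0r.
Qed.

End finite_span.

Section invariant_complemented_subspace.
Variables (R : realType) (X : completeNormedModType R[i]).
Variables (S Q : {linear X -> X}).
Hypotheses (cS : continuous S) (Sr : forall w, w != 0 -> riesz_at S w).
Hypothesis Qle : forall x, rnorm (Q x) <= rnorm x.
Hypothesis QQ : forall x, Q (Q x) = Q x.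
Hypothesis QSQ : forall x, Q (S (Q x)) = S (Q x).

Let cQ : continuous Q.
Proof. by apply: (@bounded_lin _ _ _ 1) => x; rewrite mul1r. Qed.

Let SQ : {linear X -> X} := S \o Q.

Let cSQ : continuous SQ.
Proof. by move=> x; apply: continuous_comp; [exact: cQ|exact: cS]. Qed.

(** Since [(S Q) ^ n = S ^ n Q], compressing to the range of [Q] keeps the powers
  small modulo compact operators. *)
Let SQr w : w != 0 -> riesz_at SQ w.
Proof.
move=> w0; have [_ [n [K [n0 cK SK]]]] := Sr w0.
split => //; exists n, (K \o Q : {linear X -> X}); split => // [x [M xM]|x /=].
  by apply: cK; exists M => i; exact: le_trans (Qle _) (xM i).
have -> : iter n SQ x = iter n S (Q x).
  have QSn k : Q (iter k S (Q x)) = iter k S (Q x).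
    by elim: k => [|k IH]; rewrite ?QQ// iterS -IH QSQ.
  case: n n0 {SK} => // n _; elim: n => // n IH.
  by rewrite iterS IH /= -iterS QSn.
apply: le_trans (SK _) _; rewrite ler_wpM2l// divr_ge0// exprn_ge0//.
exact: rnorm_ge0.
Qed.

(** The operator [z - S Q] has a Fitting decomposition as well. It restricts to a
  decomposition of the range of [Q], where [S Q] coincides with [S]; by uniqueness,
  it is induced there by the decomposition of [z - S]. *)
Lemma riesz_proj_invariant z p (fp : fitting_exponent S z p) (w : X) :
  z != 0 -> Q w = w ->
  Q (riesz_proj_fun fp w) = riesz_proj_fun fp w /\
  exists q u, [/\ (0 < q)%N, Q u = u &
    w - riesz_proj_fun fp w = iter q (char_op z S) u].
Proof.
move=> z0 Qw; have [p' fp'] := fitting_exponent_ex cSQ (SQr z0).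
(* A positive exponent makes [w - P w] a value of [z - S]. *)
pose q := (p + p').+1.
have pq : (p <= q)%N by rewrite /q -addnS leq_addr.
have fpq : fitting_exponent SQ z q.
  by apply: fitting_exponent_le fp'; rewrite /q -addSn leq_addl.
have LQ k x : Q x = x -> iter k (char_op z SQ) x = iter k (char_op z S) x /\
    Q (iter k (char_op z S) x) = iter k (char_op z S) x.
  move=> Qx; elim: k => // k [IH1 IH2]; rewrite !iterS IH1; split.
    by rewrite /= /char_op /= IH2.
  set y := iter k _ x in IH2 *; have QSy : Q (S y) = S y by rewrite -IH2 QSQ.
  by rewrite /= /char_op linearB linearZ_LR QSy IH2.
have fixed k x : Q (iter k (char_op z SQ) x) = iter k (char_op z SQ) x -> Q x = x.
  elim: k => // k IH; rewrite iterS => h; apply: IH.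
  set y := iter k _ x in h *; move: h.
  rewrite /= /char_op /= linearB linearZ_LR /= QSQ => /addIr h.
  exact: (scalerI z0).
have [u uw] := fitting_split fpq w.
set n := w - iter q _ u in uw.
have Qn : Q n = n by apply: (fixed q); rewrite uw linear0.
have Qu : Q u = u.
  apply: (fixed q); have -> : iter q (char_op z SQ) u = w - n by rewrite /n subKr.
  by rewrite linearB Qw Qn.
have nE : n = w - iter q (char_op z S) u by rewrite /n (LQ q u Qu).1.
have Pw : riesz_proj_fun fp w = n.
  apply: (riesz_proj_uniq fp pq); first by rewrite -(LQ q n Qn).1.
  by exists u => //; rewrite nE subKr.
rewrite Pw; split => //; exists q, u; split => //.
by rewrite nE subKr.
Qed.

End invariant_complemented_subspace.

(** * Vector lattices *)

Section vector_lattice_complements.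
Variables (R : realType) (E : banachLatticeType R).
Implicit Types (x y z u v w a : E) (c : R).

Local Notation join := (@Order.join _ _ : E -> E -> E).
Local Notation meet := (@Order.meet _ _ : E -> E -> E).

Lemma lev_D2l z x y : (z + x <= z + y) = (x <= y).
Proof. by rewrite -[LHS]subv_ge0 opprD addrACA subrr add0r subv_ge0. Qed.

Lemma lev_addr_ge0 x y : 0 <= x -> 0 <= y -> 0 <= x + y.
Proof. by move=> x0 y0; rewrite -[0]addr0; exact: lev_D. Qed.

Lemma lev_subl x y z : (x - y <= z) = (x <= z + y).
Proof. by rewrite -[LHS](lev_D2l y) [y + (x - y)]addrC subrK [y + z]addrC. Qed.

Lemma lev_subr x y z : (x <= y - z) = (x + z <= y).
Proof. by rewrite -[LHS](lev_D2l z) [z + (y - z)]addrC subrK [z + x]addrC. Qed.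

Lemma lev_opp2 x y : (- x <= - y) = (y <= x).
Proof. by apply/idP/idP => /lev_N; rewrite ?opprK. Qed.

Lemma meetv_add u x y : meet x y + u = meet (x + u) (y + u).
Proof.
apply/le_anti/andP; split; first by rewrite lexI !lev_D2r// ?leIl ?leIr.
by rewrite -lev_subl lexI !lev_subl leIl leIr.
Qed.

Lemma joinv_add u x y : join x y + u = join (x + u) (y + u).
Proof.
apply/le_anti/andP; split; last by rewrite leUx !lev_D2r// ?leUl ?leUr.
by rewrite -lev_subr leUx !lev_subr leUl leUr.
Qed.

Lemma joinv_opp x y : join x y = - meet (- x) (- y).
Proof.
apply/le_anti/andP; split.
  by rewrite leUx; apply/andP; split; rewrite -lev_opp2 opprK ?leIl ?leIr.
by rewrite -lev_opp2 opprK lexI; apply/andP; split; rewrite lev_opp2 ?leUl ?leUr.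
Qed.

Lemma meetv_ge0 x y : 0 <= x -> 0 <= y -> 0 <= meet x y.
Proof. by move=> x0 y0; rewrite lexI x0. Qed.

Lemma meetv_subadd u v w : 0 <= u -> 0 <= v -> 0 <= w ->
  meet u (v + w) <= meet u v + meet u w.
Proof.
move=> u0 v0 w0; rewrite meetv_add lexI; apply/andP; split.
  apply: le_trans (leIl _ _) _; rewrite -[X in X <= _]addr0.
  by rewrite lev_D2l meetv_ge0.
rewrite [v + meet u w]addrC meetv_add lexI; apply/andP; split.
  by apply: le_trans (leIl _ _) _; rewrite -[X in X <= _]addr0 lev_D2l.
by rewrite [w + v]addrC leIr.
Qed.

Lemma vabsN x : vabs (- x) = vabs x.
Proof. by rewrite /vabs opprK joinC. Qed.

Lemma vabsD x y : vabs (x + y) <= vabs x + vabs y.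
Proof.
by apply: vabs_le; rewrite ?opprD; apply: lev_D; rewrite ?lev_vabs ?levN_vabs.
Qed.

Lemma vabsZ c x : vabs (c *: x) = `|c| *: vabs x.
Proof.
have le (d : R) (b : E) : vabs (d *: b) <= `|d| *: vabs b.
  apply: vabs_le; first exact: lev_Zabs.
  by rewrite -scaleNr -normrN; exact: lev_Zabs.
apply/le_anti; rewrite le /=.
have [->|c0] := eqVneq c 0; first by rewrite normr0 scale0r vabs_ge0.
have := le c^-1 (c *: x); rewrite scalerK// => /(lev_Z2l (normr_ge0 c)).
by rewrite scalerA -normrM divff// normr1 scale1r.
Qed.

Definition vpos x : E := join x 0.

Lemma vpos_ge0 x : 0 <= vpos x. Proof. exact: leUr. Qed.

Lemma vposN_add x : vpos (- x) + x = vpos x.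
Proof. by rewrite /vpos joinv_add addNr add0r joinC. Qed.

Lemma vpos_sub x : vpos x - vpos (- x) = x.
Proof. by rewrite -vposN_add addrC addKr. Qed.

Lemma vpos_meet x : meet (vpos x) (vpos (- x)) = 0.
Proof.
have E0 : vpos (- x) = 0 + vpos (- x) by rewrite add0r.
rewrite -(vposN_add x) addrC [X in meet _ X]E0 -meetv_add.
by rewrite /vpos [X in _ + X]joinv_opp opprK oppr0 subrr.
Qed.

Lemma vpos_le_vabs x : vpos x <= vabs x.
Proof. by rewrite leUx lev_vabs vabs_ge0. Qed.

Lemma vabs_eq0 x : vabs x = 0 -> x = 0.
Proof.
by move=> x0; apply/eqP; rewrite -normr_eq0 -norm_vabs x0 normr0.
Qed.

Lemma vabs0 : vabs (0 : E) = 0.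
Proof. exact: vabs_id. Qed.

Lemma ger0_lev_norm x y : 0 <= x -> x <= y -> `|x| <= `|y|.
Proof. by move=> x0 xy; apply: lev_norm; rewrite vabs_id. Qed.

Lemma scalev_ge0 c x : 0 <= c -> 0 <= x -> 0 <= c *: x.
Proof. by move=> c0 x0; rewrite -(scaler0 _ c); exact: lev_Z2l. Qed.

Lemma meetvZ c x y : 0 < c -> meet (c *: x) (c *: y) = c *: meet x y.
Proof.
move=> c0; have c1 : 0 <= c^-1 by rewrite invr_ge0 ltW.
have cK u : c *: (c^-1 *: u) = u by rewrite scalerA divff ?gt_eqF// scale1r.
apply/le_anti/andP; split; last first.
  by rewrite lexI !lev_Z2l ?(ltW c0) ?leIl ?leIr.
rewrite -[X in X <= _]cK; apply: lev_Z2l; first exact: ltW.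
by rewrite lexI; apply/andP; split;
  rewrite -[X in _ <= X](scalerK (lt0r_neq0 c0)); apply: lev_Z2l; rewrite ?leIl ?leIr.
Qed.

Lemma closed_lev x y : (forall e : R, 0 < e -> exists2 u, x <= y + u & `|u| <= e) ->
  x <= y.
Proof.
move=> H; apply: lev_approx => e e0; have [|u xy ue] := H (e / 2); first by rewrite divr_gt0.
by exists u => //; apply: le_lt_trans ue _; lra.
Qed.

(** Archimedean property: after division by [n], the vector [x] lies below vectors
  of arbitrarily small norm. *)
Lemma lev_archimedean x y : (forall n : nat, n%:R *: x <= y) -> x <= 0.
Proof.
move=> xy; apply: lev_approx => e e0.
pose n := (Num.truncn (`|y| / e)).+1; have n0 : 0 < n%:R :> R by rewrite ltr0n.
exists (n%:R^-1 *: vabs y).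
  rewrite add0r -[x](scalerK (lt0r_neq0 n0)); apply: lev_Z2l; first by rewrite invr_ge0 ltW.
  exact: le_trans (xy n) (lev_vabs y).
rewrite normrZ norm_vabs gtr0_norm ?invr_gt0// ltr_pdivrMl// -ltr_pdivrMr//.
exact: truncnS_gt.
Qed.

Lemma disjointC x y : disjoint_vect x y -> disjoint_vect y x.
Proof. by rewrite /disjoint_vect meetC. Qed.

Lemma disjoint_le x y z : vabs x <= vabs y -> disjoint_vect y z -> disjoint_vect x z.
Proof.
move=> xy yz; apply/le_anti/andP; split; last by rewrite meetv_ge0 ?vabs_ge0.
rewrite -yz lexI leIr andbT; apply: le_trans xy; exact: leIl.
Qed.

Lemma disjoint_pos x y : 0 <= x -> 0 <= y -> disjoint_vect x y = (meet x y = 0).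
Proof. by move=> x0 y0; rewrite /disjoint_vect !vabs_id. Qed.

Lemma disjoint0 z : disjoint_vect 0 z.
Proof.
apply/le_anti/andP; split; last by rewrite meetv_ge0 ?vabs_ge0.
by rewrite vabs0 leIl.
Qed.

Lemma disjointD x y z : disjoint_vect x z -> disjoint_vect y z -> disjoint_vect (x + y) z.
Proof.
move=> xz yz; apply/le_anti/andP; split; last by rewrite meetv_ge0 ?vabs_ge0.
apply: le_trans (_ : meet (vabs z) (vabs x + vabs y) <= _).
  by rewrite lexI leIr; apply: le_trans (vabsD x y); exact: leIl.
apply: le_trans (meetv_subadd _ _ _) _; rewrite ?vabs_ge0//.
by rewrite ![meet (vabs z) _]meetC xz yz addr0.
Qed.

Lemma disjointZ c x z : disjoint_vect x z -> disjoint_vect (c *: x) z.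
Proof.
have nat_case n : disjoint_vect x z -> disjoint_vect (n%:R *: x) z.
  move=> xz; elim: n => [|n IH]; first by rewrite scale0r; exact: disjoint0.
  by rewrite -natr1 scalerDl scale1r; exact: disjointD.
move=> /(nat_case (Num.truncn `|c|).+1); apply: disjoint_le.
rewrite !vabsZ; apply: lev_Z2r; first exact: vabs_ge0.
by rewrite [leRHS]ger0_norm// ltW// truncnS_gt.
Qed.

Lemma disjointN x z : disjoint_vect x z -> disjoint_vect (- x) z.
Proof. by rewrite -scaleN1r; exact: disjointZ. Qed.

Lemma disjointB x y z : disjoint_vect x z -> disjoint_vect y z -> disjoint_vect (x - y) z.
Proof. by move=> xz yz; apply: disjointD => //; exact: disjointN. Qed.

Lemma disjoint_self x : disjoint_vect x x -> x = 0.
Proof. by rewrite /disjoint_vect meetxx; exact: vabs_eq0. Qed.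

Lemma closedE_normP (V : set E) : closed V <->
  forall x, (forall e : R, 0 < e -> exists2 y, V y & `|x - y| < e) -> V x.
Proof.
split=> [cV x H|H x Vx].
  apply: cV => B; rewrite -nbhs_ballE => -[e /= e0 eB].
  have [y Vy xy] := H e e0; exists y; split => //; apply: eB.
  by rewrite -ball_normE.
apply: H => e e0; have /Vx[y [Vy xy]] : nbhs x (ball x e) by exact: nbhsx_ballx.
by exists y => //; move: xy; rewrite -ball_normE.
Qed.

Definition perp z : set E := [set x | disjoint_vect x z].

(** Disjointness passes to limits since [meet (vabs x) (vabs z)] is at most
  [vabs (x - y)] when [y] is disjoint from [z]. *)
Lemma perp_closed_ideal z : closed_ideal (perp z).
Proof.
split; last by move=> x y yz xy; exact: disjoint_le yz.
split; first exact: disjoint0.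
  by move=> c x y xz yz; apply: disjointD => //; exact: disjointZ.
apply/closedE_normP => x xz; apply/eqP.
rewrite -normr_le0; apply/ler_addgt0Pl => e e0; rewrite addr0.
have [y yz xy] := xz e e0.
apply: le_trans (ltW xy); rewrite -[leRHS]norm_vabs.
apply: ger0_lev_norm; first by rewrite meetv_ge0 ?vabs_ge0.
apply: le_trans (_ : meet (vabs z) (vabs (x - y) + vabs y) <= _).
  rewrite lexI leIr; apply: le_trans (leIl _ _) _.
  by apply: le_trans (vabsD _ _); rewrite subrK.
apply: le_trans (meetv_subadd _ _ _) _; rewrite ?vabs_ge0//.
by rewrite [meet _ (vabs y)]meetC yz addr0 leIr.
Qed.

End vector_lattice_complements.

(** * Band projections and complexification *)

Section band_projection.
Variables (R : realType) (E : banachLatticeType R).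
Implicit Types (x y z u v w : E) (c : R) (V W : set E).

Local Notation join := (@Order.join _ _ : E -> E -> E).
Local Notation meet := (@Order.meet _ _ : E -> E -> E).

Lemma ideal_abs W x : closed_ideal W -> W x -> W (vabs x).
Proof. by move=> [_ IW] Wx; apply: IW Wx _; rewrite vabs_id ?vabs_ge0. Qed.

Lemma ideal_le W x y : closed_ideal W -> W y -> 0 <= x -> x <= y -> W x.
Proof.
by move=> [_ IW] Wy x0 xy; apply: IW Wy _; rewrite vabs_id// (le_trans xy)// lev_vabs.
Qed.

Lemma vsubD V x y : closed_subspace V -> V x -> V y -> V (x + y).
Proof. by move=> [_ VP _] Vx Vy; rewrite -[x]scale1r; exact: VP. Qed.

Lemma vsubZ V c x : closed_subspace V -> V x -> V (c *: x).
Proof. by move=> [V0 VP _] Vx; rewrite -[_ *: _]addr0; exact: VP. Qed.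

Lemma vsubB V x y : closed_subspace V -> V x -> V y -> V (x - y).
Proof. by move=> cV Vx Vy; apply: vsubD => //; rewrite -scaleN1r; exact: vsubZ. Qed.

Hypothesis oc : order_continuous_norm E.

(** With [D] the set of positive elements of [W] below [x], the differences
  [u - v] of an upper bound [u] of [D] and an element [v] of [D] decrease to 0, by
  the Archimedean property. Order continuity turns this into norm convergence of
  [D], so that its supremum exists and stays in the closed ideal [W]. *)
Lemma band_component_pos W x : closed_ideal W -> 0 <= x ->
  exists v, [/\ W v, 0 <= v, v <= x & forall w, W w -> disjoint_vect (x - v) w].
Proof.
move=> iW x0; have [cW _] := iW; have [W0 _ clW] := cW.
pose D := [set v | [/\ W v, 0 <= v & v <= x]].
have D0 : D 0 by split.
pose B := [set u | forall v, D v -> v <= u].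
pose G := [set g | exists u v, [/\ B u, D v & g = u - v]].
have [v_ vP] : exists v_ : nat -> E, forall n, D (v_ n) /\
    exists u, B u /\ `|u - v_ n| < n.+1%:R^-1.
  suff /choice[v_ vP] : forall n : nat, exists v, D v /\
      exists u, B u /\ `|u - v| < n.+1%:R^-1 by exists v_.
  move=> n; have [||||_ [u [v [Bu Dv ->]]] uv] := oc (A := G) _ _ _ (e := n.+1%:R^-1).
  - by exists (x - 0), x, 0; split => // v [].
  - move=> _ _ [u1 [v1 [B1 D1 ->]]] [u2 [v2 [B2 D2 ->]]].
    exists (meet u1 u2 - join v1 v2); split.
    + exists (meet u1 u2), (join v1 v2); split => //.
        by move=> v Dv; rewrite lexI B1// B2.
      have [W1 v10 v1x] := D1; have [W2 v20 v2x] := D2.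
      split; last by rewrite leUx v1x.
        apply: (ideal_le iW (vsubD cW W1 W2)); first exact: le_trans v10 (leUl _ _).
        by rewrite leUx -[X in X <= _]addr0 lev_D2l v20 -[X in X <= _]add0r lev_D2r.
      exact: le_trans v10 (leUl _ _).
    + by apply: lev_D; rewrite ?leIl// lev_opp2 leUl.
    + by apply: lev_D; rewrite ?leIr// lev_opp2 leUr.
  - split => [_ [u [v [Bu Dv ->]]]|l lG]; first by rewrite subv_ge0; exact: Bu.
    apply: (@lev_archimedean _ _ _ x) => k.
    suff : B (x - k%:R *: l) by move=> /(_ _ D0); rewrite subv_ge0.
    elim: k => [|k IH]; first by rewrite scale0r subr0 => v [].
    move=> v Dv; have h : l <= x - k%:R *: l - v by apply: lG; exists (x - k%:R *: l), v.
    by rewrite -natr1 scalerDl scale1r opprD addrA lev_subr [v + l]addrC -lev_subr.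
  - by rewrite invr_gt0.
  by exists v; split => //; exists u.
have dist n m : `|v_ n - v_ m| <= n.+1%:R^-1 + m.+1%:R^-1.
  have [Dn [un [Bn unv]]] := vP n; have [Dm [um [Bm umv]]] := vP m.
  apply: le_trans (lerD (ltW unv) (ltW umv)); apply: le_trans (ler_normD _ _).
  have un0 : 0 <= un - v_ n by rewrite subv_ge0; exact: Bn.
  have um0 : 0 <= um - v_ m by rewrite subv_ge0; exact: Bm.
  apply: lev_norm; apply: vabs_le.
    by rewrite -[X in X <= _]add0r; apply: lev_D => //; apply: lev_D2r; exact: Bm.
  rewrite opprB -[X in X <= _]addr0; apply: lev_D => //; apply: lev_D2r; exact: Bn.
have small e : 0 < e -> \forall n \near \oo, n.+1%:R^-1 < e :> R.
  move=> e0; have /cvgrPdist_lt/(_ _ e0) := @cvg_harmonic R.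
  by apply: filterS => n; rewrite sub0r normrN (@ger0_norm R) /harmonic/= ?invr_ge0.
have /cauchy_cvgP cs : cauchy (v_ @ \oo).
  apply/cauchy_exP => e e0.
  have [|N _ hN] := small (e / 2); first by rewrite divr_gt0.
  exists (v_ N); exists N => // n Nn /=; rewrite -ball_normE /=.
  apply: le_lt_trans (dist _ _) _; rewrite (splitr e); by apply: ltrD; apply: hN => /=.
pose v := lim (v_ @ \oo).
have near_v e : 0 < e -> \forall n \near \oo, `|v - v_ n| < e.
  by move=> e0; move/cvgrPdist_lt : cs; exact.
have Wv : W v.
  by apply: closed_cvg clW _ _ cs; near=> n; have [[]] := vP n.
have v0 : 0 <= v.
  apply: lev_approx => e e0; near \oo => n.
  exists (v_ n - v); last by rewrite distrC; near: n; exact: near_v.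
  by rewrite addrC subrK; have [[]] := vP n.
have vx : v <= x.
  apply: lev_approx => e e0; near \oo => n.
  exists (v - v_ n); last by near: n; exact: near_v.
  rewrite addrCA -[X in X <= _]addr0 lev_D2l subv_ge0.
  by have [[]] := vP n.
have Dv d : D d -> d <= v.
  move=> Dd; apply: lev_approx => e e0.
  near \oo => n; have [_ [u [Bu uv]]] := vP n.
  exists (u - v_ n + (v_ n - v)).
    by rewrite [u - v_ n + _]addrA subrK addrCA subrr addr0; exact: Bu.
  rewrite (splitr e); apply: le_lt_trans (ler_normD _ _) _; apply: ltrD.
    apply: lt_trans uv _; near: n; apply: small; by rewrite divr_gt0.
  by rewrite distrC; near: n; apply: near_v; rewrite divr_gt0.
exists v; split => // w Ww.
have xv0 : 0 <= x - v by rewrite subv_ge0.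
rewrite /disjoint_vect (vabs_id xv0); set m := Order.meet _ _.
have m0 : 0 <= m by rewrite meetv_ge0 ?vabs_ge0.
apply/le_anti/andP; split => //.
rewrite -(lev_D2l v) addr0; apply: Dv; split.
- apply: vsubD => //; apply: (ideal_le iW (ideal_abs iW Ww) m0); exact: leIr.
- exact: lev_addr_ge0.
by rewrite -[X in _ <= X](subrK v) [x - v + v]addrC lev_D2l leIl.
Unshelve. all: by end_near. Qed.

Variable W : set E.
Hypothesis iW : closed_ideal W.
Let cW : closed_subspace W. Proof. exact: iW.1. Qed.

Lemma band_component_uniq x v v' : W v -> W v' ->
  (forall w, W w -> disjoint_vect (x - v) w) ->
  (forall w, W w -> disjoint_vect (x - v') w) -> v = v'.
Proof.
move=> Wv Wv' xv xv'; apply/eqP; rewrite -subr_eq0; apply/eqP.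
have Wvv : W (v - v') by exact: vsubB.
apply: disjoint_self; rewrite {1}(_ : v - v' = (x - v') - (x - v)).
  by apply: disjointB; [exact: xv'|exact: xv].
by rewrite subr_subl.
Qed.

Lemma band_component_ex x : exists v, W v /\ forall w, W w -> disjoint_vect (x - v) w.
Proof.
have [v [Wv _ _ vP]] := band_component_pos iW (vpos_ge0 x).
have [u [Wu _ _ uP]] := band_component_pos iW (vpos_ge0 (- x)).
exists (v - u); split; first exact: vsubB.
move=> w Ww; have -> : x - (v - u) = (vpos x - v) - (vpos (- x) - u).
  by rewrite -{1}(vpos_sub x) !opprD !opprK addrACA.
by apply: disjointB; [exact: vP|exact: uP].
Qed.

Definition band_proj x : E := sval (cid (band_component_ex x)).

Lemma band_proj_in x : W (band_proj x).
Proof. exact: (svalP (cid (band_component_ex x))).1. Qed.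

Lemma band_proj_disjoint x w : W w -> disjoint_vect (x - band_proj x) w.
Proof. exact: (svalP (cid (band_component_ex x))).2. Qed.

Lemma band_projE x v : W v -> (forall w, W w -> disjoint_vect (x - v) w) ->
  band_proj x = v.
Proof.
by move=> Wv xv; apply: (@band_component_uniq x) => //; [exact: band_proj_in|
  exact: band_proj_disjoint].
Qed.

Lemma band_proj_linear : linear band_proj.
Proof.
move=> c x y; apply: band_projE => [|w Ww].
  by apply: vsubD => //; [apply: vsubZ => //|]; exact: band_proj_in.
rewrite opprD addrACA -scalerBr; apply: disjointD; last exact: band_proj_disjoint.
by apply: disjointZ; exact: band_proj_disjoint.
Qed.

HB.instance Definition _ := GRing.isLinear.Build R E E *:%R band_proj band_proj_linear.

Lemma band_proj_id x : W x -> band_proj x = x.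
Proof.
move=> Wx; apply: band_projE => // w Ww; rewrite subrr; exact: disjoint0.
Qed.

Lemma band_proj_pos x : 0 <= x -> 0 <= band_proj x /\ band_proj x <= x.
Proof.
move=> x0; have [v [Wv v0 vx vP]] := band_component_pos iW x0.
by rewrite (band_projE Wv vP).
Qed.

Lemma band_proj_mono x y : x <= y -> band_proj x <= band_proj y.
Proof.
by rewrite -subv_ge0 => /band_proj_pos[+ _]; rewrite linearB subv_ge0.
Qed.

End band_projection.

Section complexified_operators.
Variables (R : realType) (E : banachLatticeType R).
Local Notation EC := (complexification E).

Lemma complexify_linear (T : {linear E -> E}) :
  linear (complexify T : EC -> EC).
Proof.
move=> c z w; rewrite /complexify !complexificationZ /=.
congr pair; first by rewrite linearD [T (_ - _)]linearB ![T (_ *: _)]linearZ_LR.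
by rewrite [LHS]linearD [T (_ + _)]linearD ![T (_ *: _)]linearZ_LR.
Qed.

HB.instance Definition _ (T : {linear E -> E}) :=
  GRing.isLinear.Build R[i] EC EC *:%R (complexify T) (complexify_linear T).

Lemma rnorm_complexification (z : EC) : rnorm z = `|modulus z|.
Proof. by []. Qed.

Lemma rnorm_le_sum (z : EC) : rnorm z <= `|z.1| + `|z.2|.
Proof.
rewrite rnorm_complexification -(norm_vabs z.1) -(norm_vabs z.2).
apply: le_trans (ler_normD _ _); apply: ger0_lev_norm (modulus_le z).
exact: modulus_ge0.
Qed.

Lemma norm1_le_rnorm (z : EC) : `|z.1| <= rnorm z.
Proof. by rewrite rnorm_complexification; exact/lev_norm/vabs1_modulus. Qed.

Lemma norm2_le_rnorm (z : EC) : `|z.2| <= rnorm z.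
Proof. by rewrite rnorm_complexification; exact/lev_norm/vabs2_modulus. Qed.

(** A positive projection below the identity does not increase the modulus, which
  is the supremum of the real parts of rotated vectors. *)
Lemma band_proj_contraction (oc : order_continuous_norm E) (W : set E)
    (iW : closed_ideal W) (z : EC) :
  rnorm (complexify (band_proj oc iW) z : EC) <= rnorm z.
Proof.
rewrite !rnorm_complexification; apply: ger0_lev_norm; first exact: modulus_ge0.
apply: modulus_least => c s cs; rewrite /= -!linearZ_LR -linearD.
apply: le_trans (band_proj_mono _ _ (modulus_ub z cs)) _.
by have [] := band_proj_pos oc iW (modulus_ge0 z).
Qed.

(** The complexification of a subspace. *)
Definition cset (W : set E) : set EC := [set z | W z.1 /\ W z.2].

Lemma cset_subspace (W : set E) : closed_subspace W -> subspace_of (cset W).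
Proof.
move=> cW; split => [|c x y [x1 x2] [y1 y2]]; first by split; case: cW.
rewrite complexificationZ; split => /=; apply: vsubD => //.
  by apply: vsubB => //; exact: vsubZ.
by apply: vsubD => //; exact: vsubZ.
Qed.

Lemma cset_closed (W : set E) : closed_subspace W -> closed (cset W).
Proof.
move=> [_ _ /closedE_normP cW]; apply/closed_rnormP => z zW.
split; apply: cW => e e0; have [w [w1 w2] zw] := zW e e0.
  by exists w.1 => //; apply: le_lt_trans zw; exact: (norm1_le_rnorm (z - w)).
by exists w.2 => //; apply: le_lt_trans zw; exact: (norm2_le_rnorm (z - w)).
Qed.

End complexified_operators.

(** * Atoms and their coordinates *)

Section atoms.
Variables (R : realType) (E : banachLatticeType R).
Implicit Types (x y a b : E) (c l t : R).

Local Notation join := (@Order.join _ _ : E -> E -> E).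
Local Notation meet := (@Order.meet _ _ : E -> E -> E).

Lemma lev_perturb x y a : (forall t, 0 < t -> x <= y + t *: a) -> x <= y.
Proof.
move=> H; apply: closed_lev => e e0; pose t := e / (`|a| + 1).
have a1 : 0 < `|a| + 1 by rewrite ltr_wpDl.
have t0 : 0 < t by rewrite divr_gt0.
exists (t *: a); first exact: H.
rewrite normrZ gtr0_norm// /t -mulrA ler_piMr ?(ltW e0)//.
by rewrite ler_pdivrMl// mulr1 lerDl.
Qed.

(** The coefficients [t] with [t *: a <= x] are bounded by the Archimedean
  property, and their supremum is attained because the order is closed. *)
Lemma largest_multiple a x : 0 <= a -> a != 0 -> 0 <= x ->
  exists l, [/\ 0 <= l, l *: a <= x & forall t, t *: a <= x -> t <= l].
Proof.
move=> a0 an0 x0; pose A : set R := [set t | t *: a <= x].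
have A0 : A 0 by rewrite /A /= scale0r.
have [n nA] : exists n : nat, ~~ (n%:R *: a <= x).
  apply: contrapT => H; move/eqP: an0; apply; apply/le_anti; rewrite a0 andbT.
  apply: (@lev_archimedean _ _ _ x) => n; apply/negPn/negP => nA.
  by apply: H; exists n.
have An : ubound A n%:R.
  move=> t At; rewrite leNgt; apply/negP => nt; move/negP: nA; apply.
  by apply: le_trans At; apply: lev_Z2r => //; exact: ltW.
have supA : has_sup A by split; [exists 0|exists n%:R].
exists (sup A); split.
- by apply: ub_le_sup => //; exists n%:R.
- apply: (@lev_perturb _ _ a) => t t0.
  have [s As st] := sup_adherent t0 supA.
  apply: le_trans (_ : (s + t) *: a <= _).
    by apply: lev_Z2r => //; rewrite -lerBlDr ltW.
  by rewrite scalerDl lev_D2r.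
- by move=> t At; apply: ub_le_sup => //; exists n%:R.
Qed.

(** The positive and negative parts of [y - t *: a] are disjoint, so one of them
  vanishes. *)
Lemma atom_comparable a y t : atom a -> 0 <= y <= a ->
  y <= t *: a \/ t *: a <= y.
Proof.
move=> [a0 an0 aP] /andP[y0 ya].
have [t0|t0] := leP 0 t; last first.
  right; apply: le_trans y0; rewrite -[X in _ <= X](scale0r a).
  by apply: lev_Z2r => //; exact: ltW.
pose p := vpos (y - t *: a); pose q := vpos (- (y - t *: a)).
have pq : meet p q = 0 by exact: vpos_meet.
pose s := 1 + t; have s0 : 0 < s by rewrite ltr_wpDr.
have s1 : 0 < s^-1 by rewrite invr_gt0.
have sa u : u <= s *: a -> s^-1 *: u <= a.
  move=> us; rewrite -[a](scalerK (lt0r_neq0 s0)).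
  by apply: lev_Z2l => //; exact: ltW.
have ta0 : 0 <= t *: a by exact: scalev_ge0.
have ps : p <= s *: a.
  rewrite leUx scalev_ge0 ?(ltW s0)// andbT lev_subl; apply: le_trans ya _.
  rewrite /s scalerDl scale1r -addrA -[X in X <= _]addr0 lev_D2l.
  exact: lev_addr_ge0.
have qs : q <= s *: a.
  rewrite leUx scalev_ge0 ?(ltW s0)// andbT opprB lev_subl /s scalerDl scale1r.
  rewrite addrAC addrC -[X in X <= _]addr0 lev_D2l; exact: lev_addr_ge0.
have pos (u : E) : 0 <= u -> 0 <= s^-1 *: u by move=> u0; apply: scalev_ge0 => //; exact: ltW.
have [||||] := aP (s^-1 *: p) (s^-1 *: q).
- by rewrite pos ?vpos_ge0// sa.
- by rewrite pos ?vpos_ge0// sa.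
- by rewrite disjoint_pos ?pos ?vpos_ge0// meetvZ// pq scaler0.
- move=> /(congr1 (fun u => s *: u)); rewrite scalerA divff ?gt_eqF// scale1r scaler0.
  move=> p0; left; rewrite -[X in _ <= X]add0r -lev_subl -p0; exact: leUl.
- move=> /(congr1 (fun u => s *: u)); rewrite scalerA divff ?gt_eqF// scale1r scaler0.
  move=> q0; right; rewrite -subv_ge0 -lev_opp2 oppr0 -q0; exact: leUl.
Qed.

(** Beyond the largest coefficient [l] with [l *: a <= y], the other side of the
  comparison holds. *)
Lemma below_atom a y : atom a -> 0 <= y <= a -> exists c, y = c *: a.
Proof.
move=> Aa /[dup] ya /andP[y0 _]; have [a0 an0 _] := Aa.
have [l [_ ly lmax]] := largest_multiple a0 an0 y0.
exists l; apply/le_anti/andP; split => //.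
apply: (@lev_perturb _ _ a) => t t0; rewrite -scalerDl.
have [//|/lmax] := atom_comparable (l + t) Aa ya.
by rewrite gerDl leNgt t0.
Qed.

(** With the largest coefficient [l], the infimum of [a] and the remainder is a
  multiple of [a], which vanishes by maximality. *)
Lemma atom_split_pos a x : atom a -> 0 <= x ->
  exists l, [/\ 0 <= l, l *: a <= x & disjoint_vect (x - l *: a) a].
Proof.
move=> Aa x0; have [a0 an0 _] := Aa.
have [l [l0 lx lmax]] := largest_multiple a0 an0 x0.
exists l; split => //; have u0 : 0 <= x - l *: a by rewrite subv_ge0.
rewrite disjoint_pos//; set m := meet _ _.
have m0 : 0 <= m by exact: meetv_ge0.
have ma : 0 <= m <= a by rewrite m0 leIr.
have [c mc] := below_atom Aa ma.
apply/le_anti; rewrite m0 andbT.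
have : (l + c) *: a <= x.
  by rewrite scalerDl addrC -lev_subr -mc leIl.
move=> /lmax; rewrite gerDl => c0.
by rewrite mc -[X in _ <= X](scale0r a); exact: lev_Z2r.
Qed.

Lemma atom_split a x : atom a -> exists l, disjoint_vect (x - l *: a) a.
Proof.
move=> Aa; have [l [_ _ lP]] := atom_split_pos Aa (vpos_ge0 x).
have [k [_ _ kP]] := atom_split_pos Aa (vpos_ge0 (- x)).
exists (l - k); have -> : x - (l - k) *: a =
    (vpos x - l *: a) - (vpos (- x) - k *: a).
  by rewrite -{1}(vpos_sub x) scalerBl !opprD !opprK addrACA.
exact: disjointB.
Qed.

Lemma coordinateP a x : atom a -> disjoint_vect (x - coordinate a x *: a) a.
Proof. by move=> Aa; exact: (getPex (atom_split x Aa)). Qed.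

Lemma atom_scale_disjoint a l : atom a -> disjoint_vect (l *: a) a -> l = 0.
Proof.
move=> [_ /eqP an0 _] la; apply/eqP/negPn/negP => l0; apply: an0; apply: disjoint_self.
by rewrite -{1}[a](scalerK l0); exact: disjointZ.
Qed.

Lemma coordinateE a x l : atom a -> disjoint_vect (x - l *: a) a -> coordinate a x = l.
Proof.
move=> Aa xl; apply/eqP; rewrite -subr_eq0; apply/eqP.
apply: (atom_scale_disjoint Aa); rewrite scalerBl -(subr_subl x).
by apply: disjointB => //; exact: coordinateP.
Qed.

Lemma coordinate_linear a : atom a -> linear_for *%R (coordinate a).
Proof.
move=> Aa c x y; apply: coordinateE => //.
rewrite scalerDl -scalerA opprD addrACA -scalerBr; apply: disjointD.
  by apply: disjointZ; exact: coordinateP.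
exact: coordinateP.
Qed.

Lemma coordinate_eq0 a x : atom a -> (coordinate a x = 0) <-> disjoint_vect x a.
Proof.
move=> Aa; split => [x0|xa]; last by apply: coordinateE => //; rewrite scale0r subr0.
by have := coordinateP x Aa; rewrite x0 scale0r subr0.
Qed.

Lemma coordinate_self a : atom a -> coordinate a a = 1.
Proof.
by move=> Aa; apply: coordinateE => //; rewrite scale1r subrr; exact: disjoint0.
Qed.

(** The infimum of [vabs x] and [a] is a multiple of [a] that lies in [W]. *)
Lemma ideal_atom_dichotomy (W : set E) a : closed_ideal W -> atom a -> ~ W a ->
  W `<=` perp a.
Proof.
move=> iW Aa nWa x Wx; have [a0 _ _] := Aa.
set m := meet (vabs x) (vabs a); have m0 : 0 <= m by rewrite meetv_ge0 ?vabs_ge0.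
have ma : 0 <= m <= a by rewrite m0 (le_trans (leIr _ _))// vabs_id.
have [c mc] := below_atom Aa ma.
have Wm : W m by apply: (ideal_le iW (ideal_abs iW Wx) m0); exact: leIl.
have [c0|c0] := eqVneq c 0; first by rewrite /perp /= /disjoint_vect -/m mc c0 scale0r.
by case: nWa; rewrite -[a](scalerK c0) -mc; exact: vsubZ iW.1 Wm.
Qed.

(** The infimum of two atoms is a multiple of both. *)
Lemma atoms_disjoint a b : atom a -> atom b -> ~ equivalent_atoms a b ->
  disjoint_vect a b.
Proof.
move=> Aa Ab nab; have [a0 _ _] := Aa; have [b0 _ _] := Ab.
rewrite disjoint_pos//; set m := meet a b.
have m0 : 0 <= m by exact: meetv_ge0.
have [c mc] : exists c, m = c *: a by apply: below_atom => //; rewrite m0 leIl.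
have [d md] : exists d, m = d *: b by apply: below_atom => //; rewrite m0 leIr.
have [//|mn0] := eqVneq m 0.
have c0 : c != 0 by apply: contraNneq mn0 => c0; rewrite mc c0 scale0r.
have d0 : d != 0 by apply: contraNneq mn0 => d0; rewrite md d0 scale0r.
have ab : a = (c^-1 * d) *: b by rewrite -scalerA -md mc scalerK.
have ba : b = (d^-1 * c) *: a by rewrite -scalerA -mc md scalerK.
case: nab; apply/seteqP; split => [_ [k _ <-]|_ [k _ <-]].
  by exists (k * (c^-1 * d)) => //; rewrite -scalerA -ab.
by exists (k * (d^-1 * c)) => //; rewrite -scalerA -ba.
Qed.

End atoms.

(** * Maximal chains of closed ideals *)

Section chain_of_ideals.
Variables (R : realType) (E : banachLatticeType R) (T : {linear E -> E}).
Variable C : set (set E).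
Hypothesis Cideal : forall V, C V -> closed_ideal V /\ (T @` V `<=` V).
Hypothesis Ctotal : total_on C subset.
Hypothesis Cmax : forall D : set (set E), C `<=` D -> D `<=` @closed_subspace R E ->
  total_on D subset -> D `<=` C.
Implicit Types (V W : set E) (G : set (set E)) (a x y : E).

(** All members of the chain used below are obtained in this way. *)
Lemma chain_comparable_in V : closed_subspace V ->
  (forall W, C W -> W `<=` V \/ V `<=` W) -> C V.
Proof.
move=> cV VC; apply: (Cmax (D := C `|` [set V])); [by left| | |by right].
  by move=> W [/Cideal[[]]|->].
move=> W1 W2 [C1|->] [C2|->]; first exact: Ctotal.
- exact: VC.
- by have [] := VC _ C2; [right|left].
- by left.
Qed.

Lemma chain_setT : C setT.
Proof.
apply: chain_comparable_in; first by split => //; exact: closedT.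
by move=> W _; left.
Qed.

Lemma chain_set0 : C [set 0].
Proof.
apply: chain_comparable_in.
  split => //; first by move=> c x y -> ->; rewrite scaler0 addr0.
  by apply: accessible_closed_set1; apply: hausdorff_accessible; exact: norm_hausdorff.
by move=> W /Cideal[[[W0 _ _] _] _]; right => _ ->.
Qed.

Lemma chain_bigcap G : G `<=` C -> C (\bigcap_(W in G) W).
Proof.
move=> GC; apply: chain_comparable_in.
  split.
  - by move=> W /GC/Cideal[[[]]].
  - move=> c x y xG yG W GW; have [[[_ WP _] _] _] := Cideal (GC _ GW).
    by apply: WP; [exact: xG|exact: yG].
  - by apply: closed_bigI => W /GC/Cideal[[[]]].
move=> W CW; have [[V [GV VW]]|H] := pselect (exists V, G V /\ V `<=` W).
  by right => x xG; apply: VW; exact: xG.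
left => x Wx V GV; have [VW|] := Ctotal (GC _ GV) CW; last exact.
by case: H; exists V.
Qed.

(** The closure of the union of [G]. *)
Definition closed_union G : set E :=
  [set x | forall e : R, 0 < e -> exists W y, [/\ G W, W y & `|x - y| < e]].

Lemma sub_closed_union G W : G W -> W `<=` closed_union G.
Proof. by move=> GW x Wx e e0; exists W, x; rewrite subrr normr0. Qed.

Lemma chain_common G W1 W2 x y : G `<=` C -> G W1 -> G W2 -> W1 x -> W2 y ->
  exists W, [/\ G W, W x & W y].
Proof.
move=> GC G1 G2 W1x W2y; have [W12|W21] := Ctotal (GC _ G1) (GC _ G2).
  by exists W2; split => //; exact: W12.
by exists W1; split => //; exact: W21.
Qed.

Lemma chain_closed_union G : G `<=` C -> G !=set0 -> C (closed_union G).
Proof.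
move=> GC [W0 GW0]; apply: chain_comparable_in; last first.
  move=> W CW; have [[V [GV WV]]|H] := pselect (exists V, G V /\ W `<=` V).
    by left => x /WV; exact: sub_closed_union.
  right => x xG; have [[[_ _ cW] _] _] := Cideal CW.
  move/closedE_normP : cW; apply => e e0; have [V [y [GV Vy xy]]] := xG e e0.
  exists y => //; have [VW|WV] := Ctotal (GC _ GV) CW; first exact: VW.
  by case: H; exists V.
split.
- by apply: (sub_closed_union GW0); have [[[]]] := Cideal (GC _ GW0).
- move=> c x y xG yG e e0.
  pose n := `|c| + 1; have n0 : 0 < n by rewrite ltr_wpDl.
  have d0 : 0 < e / 2 / n by rewrite !divr_gt0.
  have e2 : 0 < e / 2 by rewrite divr_gt0.
  have [W1 [x' [G1 W1x' xx']]] := xG _ d0; have [W2 [y' [G2 W2y' yy']]] := yG _ e2.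
  have [W [GW Wx' Wy']] := chain_common GC G1 G2 W1x' W2y'.
  have [[[_ WP _] _] _] := Cideal (GC _ GW).
  exists W, (c *: x' + y'); split => //; first exact: WP.
  have -> : c *: x + y - (c *: x' + y') = c *: (x - x') + (y - y').
    by rewrite scalerBr opprD addrACA.
  apply: le_lt_trans (ler_normD _ _) _; rewrite (splitr e); apply: ler_ltD => //.
  rewrite normrZ; apply: le_trans (_ : n * (e / 2 / n) <= _).
    by apply: ler_pM => //; [rewrite lerDl|exact: ltW].
  by rewrite mulrC divfK// gt_eqF.
- apply/closedE_normP => x xG e e0.
  have e2 : 0 < e / 2 by rewrite divr_gt0.
  have [y yG xy] := xG _ e2; have [W [z [GW Wz yz]]] := yG _ e2.
  exists W, z; split => //; rewrite (splitr e).
  by apply: le_lt_trans (ler_distD y _ _) _; apply: ltrD.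
Qed.

(** The least member containing [a]. Together with its intersection with [perp a],
  it forms the jump of the chain at the atom [a]. *)
Definition atom_ideal a : set E := \bigcap_(W in [set W | C W /\ W a]) W.

Lemma atom_ideal_chain a : C (atom_ideal a).
Proof. by apply: chain_bigcap => W []. Qed.

Lemma atom_ideal_mem a : atom_ideal a a.
Proof. by move=> W []. Qed.

(** A member that does not contain [a] is disjoint from [a], and is contained in all
  those that contain [a]. *)
Lemma atom_ideal_pred_chain a : atom a -> C (atom_ideal a `&` perp a).
Proof.
move=> Aa; have [cV _] := (Cideal (atom_ideal_chain a)).1.
have [[_ _ cP] _] := perp_closed_ideal a.
have [cPs _] := perp_closed_ideal a.
apply: chain_comparable_in.
  split.
  - by split; [case: cV|case: cPs].
  - move=> c x y [x1 x2] [y1 y2]; case: cV => _ h1 _; case: cPs => _ h2 _.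
    by split; [exact: h1|exact: h2].
  - by case: cV => _ _ h1; exact: closedI.
move=> W CW; have [Wa|nWa] := pselect (W a).
  by right => x [xV _]; apply: xV.
left => x Wx; split; last exact: (ideal_atom_dichotomy (Cideal CW).1 Aa nWa).
move=> V [CV Va]; have [VW|] := Ctotal CV CW; last exact.
by case: nWa; exact: VW.
Qed.

End chain_of_ideals.

Section jump.
Variables (R : realType) (E : banachLatticeType R) (T : {linear E -> E}).
Local Notation EC := (complexification E).
Variables (V : set E) (a : E).
Hypotheses (cV : closed_subspace V) (TV : forall x, V x -> V (T x)).
Hypothesis TU : forall x, V x -> perp a x -> perp a (T x).
Hypotheses (Aa : atom a) (Va : V a).

Definition ccoordinate (z : EC) : R[i] := coordinate a z.1 +i* coordinate a z.2.

Definition catom : EC := (a, 0).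

Lemma coordinate0 : coordinate a 0 = 0.
Proof. by apply/(coordinate_eq0 _ Aa); exact: disjoint0. Qed.

Lemma coordinateZD c x y :
  coordinate a (c *: x + y) = c * coordinate a x + coordinate a y.
Proof. exact: (coordinate_linear Aa). Qed.

Lemma ccoordinate_linear c z w :
  ccoordinate (c *: z + w) = c * ccoordinate z + ccoordinate w.
Proof.
rewrite /ccoordinate complexificationZ /= -!scaleNr -!addrA !coordinateZD.
by case: c => p q; apply/eqP; rewrite eq_complex /=; apply/andP; split; apply/eqP; ring.
Qed.

Lemma ccoordinate0 : ccoordinate 0 = 0.
Proof. by rewrite /ccoordinate /= coordinate0. Qed.

Lemma ccoordinateZ c z : ccoordinate (c *: z) = c * ccoordinate z.
Proof. by rewrite -[c *: z]addr0 ccoordinate_linear ccoordinate0 addr0. Qed.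

Lemma ccoordinateB z w : ccoordinate (z - w) = ccoordinate z - ccoordinate w.
Proof. by rewrite addrC -scaleN1r ccoordinate_linear mulN1r addrC. Qed.

Lemma ccoordinate_catom : ccoordinate catom = 1.
Proof. by rewrite /ccoordinate /= coordinate_self// coordinate0. Qed.

Lemma ccoordinate_eq0 (z : EC) : ccoordinate z = 0 <-> cset (perp a) z.
Proof.
split; last first.
  by move=> [/(coordinate_eq0 _ Aa) z1 /(coordinate_eq0 _ Aa) z2]; rewrite /ccoordinate z1 z2.
by move=> [] /(coordinate_eq0 _ Aa) z1 /(coordinate_eq0 _ Aa) z2.
Qed.

Lemma coordinate_T x : V x -> coordinate a (T x) = diagonal_entry T a * coordinate a x.
Proof.
move=> Vx; have xE : T x = coordinate a x *: T a + T (x - coordinate a x *: a).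
  by rewrite linearB linearZ_LR addrC subrK.
rewrite xE coordinateZD mulrC (_ : coordinate a (T (x - _)) = 0) ?addr0//.
apply/(coordinate_eq0 _ Aa); apply: TU; last exact: coordinateP.
by apply: vsubB => //; exact: vsubZ.
Qed.

Local Notation S := (complexify T : {linear EC -> EC}).

(** Modulo the elements of [V] disjoint from [a], the operator acts on [V] as
  multiplication by its diagonal entry. *)
Lemma ccoordinate_char_pow (z : R[i]) k (x : EC) : cset V x ->
  cset V (iter k (char_op z S) x) /\
  ccoordinate (iter k (char_op z S) x) =
    (z - (diagonal_entry T a)%:C) ^+ k * ccoordinate x.
Proof.
move=> Vx; elim: k => [|k [Vk IH]]; first by rewrite expr0 mul1r.
rewrite !iterS; set y := iter k _ x in Vk IH *; split.
  apply: sub_sub (cset_subspace cV) _ _; last first.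
    by case: Vk => y1 y2; split => /=; exact: TV.
  exact: sub_scale (cset_subspace cV) Vk.
have SE : ccoordinate (S y) = (diagonal_entry T a)%:C * ccoordinate y.
  case: Vk => y1 y2; rewrite /ccoordinate /= !coordinate_T//.
  by apply/eqP; rewrite eq_complex /=; apply/andP; split; apply/eqP; ring.
by rewrite /= /char_op ccoordinateB ccoordinateZ SE IH exprS; ring.
Qed.

End jump.

(** * Diagonal entries and algebraic multiplicities *)

Section ringrose.
Variables (R : realType) (E : banachLatticeType R) (T : {linear E -> E}).
Local Notation EC := (complexification E).
Variable A : set E.
Hypothesis oc : order_continuous_norm E.
Hypothesis Srz : riesz_operator (complexify T : EC -> EC).
Hypothesis maxA : maximal_nonequivalent_atoms A.
Variable C : set (set E).
Hypothesis Cideal : forall V, C V -> closed_ideal V /\ (T @` V `<=` V).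
Hypothesis Ctotal : total_on C subset.
Hypothesis Cmax : forall D : set (set E), C `<=` D -> D `<=` @closed_subspace R E ->
  total_on D subset -> D `<=` C.

Local Notation S := (complexify T : {linear EC -> EC}).

Let cS : continuous S. Proof. exact: Srz.1.2. Qed.

Let Sr w : w != 0 -> riesz_at S w.
Proof. exact: (@riesz_operator_riesz_at R EC S w Srz). Qed.

Variable z : R[i].
Hypothesis z0 : z != 0.
Variable p : nat.
Hypothesis fp : fitting_exponent S z p.
Local Notation L := (char_op z S : {linear EC -> EC}).
Local Notation P := (riesz_proj_fun fp : {linear EC -> EC}).

Lemma chain_subspace W : C W -> closed_subspace W.
Proof. by move=> /Cideal[[]]. Qed.

Lemma chain_stable W x : C W -> W x -> W (T x).
Proof. by move=> /Cideal[_ TW] Wx; apply: TW; exists x. Qed.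

(** Members of the chain are projection bands, so the spectral projection leaves
  their complexifications invariant. *)
Lemma riesz_proj_chain (W : set E) (w : EC) : C W -> cset W w ->
  cset W (P w) /\ exists q u, [/\ (0 < q)%N, cset W u & w - P w = iter q L u].
Proof.
move=> CW Ww; have [iW _] := Cideal CW.
pose Q : {linear EC -> EC} := complexify (band_proj oc iW).
have QE (x : EC) : Q x = x <-> cset W x.
  split=> [<-|[x1 x2]]; first by split; exact: band_proj_in.
  by rewrite /Q /= /complexify !band_proj_id//; case: (x).
have Qin (x : EC) : cset W (Q x) by split; exact: band_proj_in.
have Qle (x : EC) : rnorm (Q x) <= rnorm x by exact: band_proj_contraction.
have QQ (x : EC) : Q (Q x) = Q x by apply/QE.
have QSQ (x : EC) : Q (S (Q x)) = S (Q x).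
  by apply/QE; have [q1 q2] := Qin x; split; exact: chain_stable.
have /QE Qw := Ww.
have [/QE PW [q [u [q0 /QE Wu uE]]]] :=
  riesz_proj_invariant cS Sr Qle QQ QSQ fp z0 Qw.
by split => //; exists q, u.
Qed.

Lemma catom_cset (W : set E) (a : E) : closed_subspace W -> W a -> cset W (catom a).
Proof. by move=> cW Wa; split => //; case: cW. Qed.

(** On [W], the coordinate of [a] intertwines [z - S] with the scalar
  [z - diagonal_entry T a]. If this scalar is 0, the coordinate vanishes at
  [catom a - P (catom a)], a value of [z - S]; otherwise it vanishes at
  [P (catom a)], which some power of [z - S] annihilates. *)
Lemma riesz_proj_diagonal (W : set E) (a : E) : C W -> W a -> atom a -> C (W `&` perp a) ->
  ccoordinate a (P (catom a)) = ((diagonal_entry T a)%:C == z)%:R.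
Proof.
move=> CW Wa Aa CU; have cW := chain_subspace CW.
have TW x : W x -> W (T x) by exact: chain_stable.
have TU x : W x -> perp a x -> perp a (T x).
  by move=> Wx ax; have [] := @chain_stable _ x CU (conj Wx ax).
have cp := ccoordinate_char_pow cW TW TU Aa Wa z.
have aW := catom_cset cW Wa.
have [PW [q [u [q0 Wu uE]]]] := riesz_proj_chain CW aW.
have [az|/eqP az] := eqVneq (diagonal_entry T a)%:C z.
  have [_] := cp q u Wu; rewrite -uE az subrr expr0n eqn0Ngt q0 mul0r.
  rewrite ccoordinateB// ccoordinate_catom//.
  by move/eqP; rewrite subr_eq0 => /eqP <-.
have [_] := cp p _ PW; rewrite riesz_proj_ker ccoordinate0// => /esym/eqP.
rewrite mulf_eq0 expf_eq0 subr_eq0 => /orP[/andP[_ /eqP za]|/eqP//].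
by case: az.
Qed.

Definition diagonal_atoms : set E := [set a | A a /\ (diagonal_entry T a)%:C = z].

Lemma A_atom a : A a -> atom a.
Proof. by have [[+ _] _] := maxA; apply. Qed.

Lemma exists_largest_atom_ideal (f : nat -> E) (s : seq nat) : s != [::] ->
  exists2 i, i \in s & forall j, j \in s ->
    atom_ideal C (f j) `<=` atom_ideal C (f i).
Proof.
elim: s => // i s IH _; have [->|/IH[k ks kmax]] := eqVneq s [::].
  by exists i; rewrite ?inE// => j; rewrite inE => /eqP ->.
have [ik|ki] := Ctotal (atom_ideal_chain Cideal Ctotal Cmax (f i))
  (atom_ideal_chain Cideal Ctotal Cmax (f k)).
  by exists k; rewrite ?inE ?ks ?orbT// => j; rewrite inE => /predU1P[->//|/kmax].
exists i; rewrite ?inE ?eqxx// => j; rewrite inE => /predU1P[->//|/kmax jk].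
exact: subset_trans jk ki.
Qed.

(** With respect to the coordinates, the images under [P] of the atoms with
  diagonal entry [z] form a unitriangular system: in a relation between them, look
  at an atom whose ideal is largest; the other atoms are disjoint from it and lie in
  the member of the chain just below. *)
Lemma riesz_proj_atoms_free (f : nat -> E) m (c : nat -> R[i]) :
  (forall i, (i < m)%N -> diagonal_atoms (f i)) ->
  (forall i j, (i < m)%N -> (j < m)%N -> f i = f j -> i = j) ->
  \sum_(i < m) c i *: P (catom (f i)) = 0 -> forall i, (i < m)%N -> c i = 0.
Proof.
move=> fA finj sum0 i im; apply/eqP/negPn/negP => ci.
pose s := [seq j <- iota 0 m | c j != 0].
have sP j : (j \in s) = (c j != 0) && (j < m)%N.
  by rewrite mem_filter mem_iota.
have [|k] := @exists_largest_atom_ideal f s.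
  by apply/eqP => s0; have := sP i; rewrite s0 in_nil ci im.
rewrite sP => /andP[ck km] kmax.
have [Ak dk] := fA k km; have Aak := A_atom Ak.
pose V := atom_ideal C (f k).
have CV : C V by exact: (atom_ideal_chain Cideal Ctotal Cmax).
have CU : C (V `&` perp (f k)) by exact: (atom_ideal_pred_chain Cideal Ctotal Cmax).
have Vk : V (f k) by exact: atom_ideal_mem.
have ccD : {morph ccoordinate (f k) : x y / x + y}.
  by move=> x y; rewrite -[x]scale1r ccoordinate_linear// mul1r scale1r.
have := congr1 (ccoordinate (f k)) sum0.
rewrite (big_morph _ ccD (ccoordinate0 Aak)) ccoordinate0//.
rewrite (bigD1 (Ordinal km)) //= ccoordinateZ// (riesz_proj_diagonal CV)// dk eqxx mulr1.
rewrite big1 ?addr0 => [/eqP|j jk]; first by rewrite (negbTE ck).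
rewrite ccoordinateZ//; have [->|cj] := eqVneq (c j) 0; first by rewrite mul0r.
suff -> : ccoordinate (f k) (P (catom (f j))) = 0 by rewrite mulr0.
apply/(ccoordinate_eq0 Aak).
have [Aj dj] := fA j (ltn_ord j).
have Vj : (V `&` perp (f k)) (f j).
  split; first by apply: (kmax j); rewrite ?sP ?cj ?ltn_ord//; exact: atom_ideal_mem.
  apply: atoms_disjoint => //; first exact: A_atom.
  have [[_ nA] _] := maxA => /(nA _ _ Aj Ak)/finj => /(_ (ltn_ord j) km) jkE.
  by move/eqP: jk; apply; apply: val_inj.
have [+ _] := riesz_proj_chain CU (catom_cset (chain_subspace CU) Vj).
by move=> [[_ h1] [_ h2]]; split.
Qed.

Let ker_in (x : EC) : iter p L x = 0 -> P x = x.
Proof. by move=> px; apply/(riesz_proj_id fp). Qed.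

Let P_in (x : EC) : iter p L (P x) = 0.
Proof. exact: riesz_proj_ker. Qed.

(** Vanishing on the kernel part, the semi-Fredholm operator [(z - S) ^ p] makes
  all bounded sequences of that part converge along [ufree]. *)
Lemma kernel_no_separated_sequence (v : nat -> EC) :
  (forall i, iter p L (v i) = 0) -> (forall i, rnorm (v i) = 1) ->
  (forall i j, (i < j)%N -> 1 / 2 <= rnorm (v i - v j)) -> False.
Proof.
move=> vN v1 sep; have cv : cvg (v @ ufree).
  apply: (@char_pow_semi_fredholm _ _ S z cS (Sr z0) p v).
    by apply: (@bdd_le _ _ _ 1) => i; rewrite v1.
  apply/cvg_ex; exists 0; rewrite (_ : _ \o v = fun=> 0); first exact: cvg_cst.
  by apply/funext => i /=; rewrite vN.
have [|i [j [ij]]] := ufree_cvg_close _ cv (e := 1 / 2); first by rewrite divr_gt0.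
by rewrite ltNge sep.
Qed.

(** Infinitely many such atoms would provide a strictly increasing sequence of
  closed subspaces of the kernel part. *)
Lemma finite_diagonal_atoms : finite_set diagonal_atoms.
Proof.
apply: contrapT => /infiniteP/pcard_leP/unsquash f.
pose e i : EC := P (catom (f i)).
have eN i : iter p L (e i) = 0 by exact: P_in.
have fA i : diagonal_atoms (f i) by exact: funS.
have finj i j : f i = f j -> i = j by apply: inj; rewrite inE.
have en i : ~ span_below e i (e i).
  move=> [c ei].
  pose d j := if (j < i)%N then c j else -1.
  have /(_ i (ltnSn i)) : forall j, (j < i.+1)%N -> d j = 0.
    apply: (@riesz_proj_atoms_free f) => [j _//|j k _ _|]; first exact: finj.
    rewrite big_ord_recr /= {2}/d ltnn scaleN1r -/(e i) [X in _ - X]ei.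
    rewrite (eq_bigr (fun j : 'I_i => c j *: e j)) ?subrr// => j _.
    by rewrite /d ltn_ord.
  by rewrite /d ltnn => /eqP; rewrite oppr_eq0 oner_eq0.
have sub_span i j : (i <= j)%N -> span_below e i `<=` span_below e j.
  move=> /subnK <-; elim: (j - i)%N => // k IH x /IH xk.
  by rewrite addSn span_belowS; exists 0; rewrite scale0r subr0.
have /choice[v vP] : forall i, exists v, [/\ span_below e i.+1 v, rnorm v = 1 &
    forall y, span_below e i y -> 1 / 2 <= rnorm (v - y)].
  move=> i; have [sY cY] := span_below_closed_subspace e i.
  have [sZ _] := span_below_closed_subspace e i.+1.
  apply: (riesz_almost_orthogonal sY cY sZ _ _ (en i)); first exact: sub_span.
  exact: span_below_mem.
apply: (@kernel_no_separated_sequence v) => [i|i|i j ij].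
- have [[c ->] _ _] := vP i; rewrite linear_sum big1// => j _.
  by rewrite linearZ_LR /= eN scaler0.
- by have [] := vP i.
have [vi _ _] := vP i; have [_ _ vj] := vP j.
by rewrite rdistC; apply: vj; exact: (sub_span i.+1).
Qed.

(** If [a] were equivalent to no member of [A], the family could be enlarged by
  [a]. *)
Lemma atom_representative a : atom a -> exists b c, [/\ A b, c != 0 & a = c *: b].
Proof.
move=> Aa; have [[AA nA] Amax] := maxA.
have [b Ab ab] : exists2 b, A b & equivalent_atoms a b.
  apply: contrapT => H; have Aa' : A a.
    apply: (Amax (A `|` [set a])) => [|x|]; [|by left|by right].
    split => [x [/AA//|->//]|x y [Ax|->] [Ay|->] xy //].
    - exact: nA.
    - by case: H; exists x => //; exact/esym.
    - by case: H; exists y.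
  by apply: H; exists a.
have : [set c *: a | c in [set: R]] a by exists 1 => //; rewrite scale1r.
rewrite ab => -[c _ ca]; exists b, c; split => //.
by apply/eqP => c0; have [_ /eqP an0 _] := Aa; apply: an0; rewrite -ca c0 scale0r.
Qed.

Section spanning.
Variable Y : set EC.
Hypotheses (sY : subspace_of Y) (cY : closed Y).
Hypothesis YA : forall a, diagonal_atoms a -> Y (P (catom a)).

(** The members of the chain whose trace on the range of [P] is contained in [Y]
  are separated from the others by a jump. *)
Let small W := forall x : EC, iter p L x = 0 -> cset W x -> Y x.

Let Gs := [set W | C W /\ small W].
Let Gl := [set W | C W /\ ~ small W].

(** The projection is continuous, leaves every member invariant and fixes the
  vectors considered, and [Y] is closed. *)
Lemma closed_union_small : small (closed_union Gs).
Proof.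
have cP : continuous P by exact: (@riesz_proj_continuous _ _ S z cS Sr z0 p fp).
have [M M0 PM] := lin_bounded (A := P) cP.
move=> x xN [x1 x2]; move/closed_rnormP : cY; apply => e e0.
have d0 : 0 < e / M / 2 by rewrite !divr_gt0.
have [W1 [y1 [G1 W1y xy1]]] := x1 _ d0; have [W2 [y2 [G2 W2y xy2]]] := x2 _ d0.
have [W [[CW sW] Wy1 Wy2]] : exists W, [/\ Gs W, W y1 & W y2].
  by apply: (chain_common Ctotal _ G1 G2) => // V [].
have Wy : cset W ((y1, y2) : EC) by [].
exists (P ((y1, y2) : EC)).
  apply: sW; first exact: P_in.
  by have [] := riesz_proj_chain CW Wy.
rewrite -{1}(ker_in xN) -linearB; apply: le_lt_trans (PM _) _.
rewrite -ltr_pdivlMl// mulrC; apply: le_lt_trans (rnorm_le_sum _) _.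
by rewrite (splitr (e / M)); exact: ltrD.
Qed.

(** On the kernel part, the intersection is already attained by one member:
  otherwise the traces of a sequence of members would decrease strictly, and F.
  Riesz's lemma would provide a separated sequence of unit vectors. *)
Lemma bigcap_large : Gl !=set0 -> ~ small (\bigcap_(W in Gl) W).
Proof.
move=> [W0 GW0].
have [W [GW Wmin]] : exists W, Gl W /\ forall W', Gl W' -> W' `<=` W ->
    forall x : EC, iter p L x = 0 -> cset W x -> cset W' x.
  apply: contrapT => H.
  have next (W : {W | Gl W}) : {W' : {W | Gl W} | sval W' `<=` sval W /\
      exists x : EC, [/\ iter p L x = 0, cset (sval W) x & ~ cset (sval W') x]}.
    apply: cid; case: W => W GW /=; apply: contrapT => H'; apply: H; exists W.
    split => // W' GW' W'W x xN Wx; apply: contrapT => W'x; apply: H'.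
    by exists (exist _ W' GW'); split => //; exists x.
  have [g [_ gP]] := dependent_choice next (exist _ W0 GW0).
  pose V i := [set x : EC | iter p L x = 0 /\ cset (sval (g i)) x].
  have sV i : subspace_of (V i).
    have [CW _] := svalP (g i); have sW := cset_subspace (chain_subspace CW).
    split; first by split; [rewrite linear0|exact: sW.1].
    move=> c x y [xN Wx] [yN Wy]; split; last exact: sW.2.
    by rewrite linearP /= xN yN scaler0 addr0.
  have clV i : closed (V i).
    apply: closedI; first exact: (closed_ker cS).
    by apply: cset_closed; apply: chain_subspace; have [] := svalP (g i).
  have Vmono i j : (i <= j)%N -> V j `<=` V i.
    move=> /subnK <-; elim: (j - i)%N => // k IH x; rewrite addSn => -[xN [x1 x2]].
    by apply: IH; have [gk _] := gP (k + i)%N; split => //; split; exact: gk.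
  have /choice[v vP] : forall i, exists v, [/\ V i v, rnorm v = 1 &
      forall y, V i.+1 y -> 1 / 2 <= rnorm (v - y)].
    move=> i; have [_ [x [xN Wx nWx]]] := gP i.
    apply: (riesz_almost_orthogonal (sV i.+1) (clV i.+1) (sV i) _ (z := x)).
    - exact: Vmono.
    - by split.
    - by move=> [].
  apply: (@kernel_no_separated_sequence v) => [i|i|i j ij].
  - by have [[]] := vP i.
  - by have [] := vP i.
  have [_ _ vi] := vP i; have [vj _ _] := vP j.
  by apply: vi; exact: (Vmono i.+1 j).
have [CW nW] := GW; move=> sI; apply: nW => x xN Wx; apply: sI => //.
have Wall W' : Gl W' -> cset W' x.
  move=> GW'; have [W'W|WW'] := Ctotal GW'.1 CW; first exact: Wmin GW' W'W x xN Wx.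
  by case: Wx => x1 x2; split; exact: WW'.
by split => W' GW'; have [] := Wall W' GW'.
Qed.

(** If the range of [P] were not contained in [Y], the chain would have a jump
  [Wm < Wp] at which this range first leaves [Y]. Order continuity provides a positive
  vector [a] of [Wp] disjoint from [Wm], and maximality of the chain makes [a] an atom
  that spans [Wp] over [Wm]. Whatever its diagonal entry, [P (catom a)] is in [Y],
  and so is the trace of [Wp]. *)
Lemma riesz_proj_atoms_span (x : EC) : iter p L x = 0 -> Y x.
Proof.
move=> xN; apply: contrapT => nYx.
pose Wm := closed_union Gs; pose Wp := \bigcap_(W in Gl) W.
have GsC : Gs `<=` C by move=> W [].
have Gs0 : Gs [set 0].
  split; first exact: (chain_set0 Cideal Ctotal Cmax).
  move=> y _ [] /=; case: y => y1 y2 /= -> ->; exact: sY.1.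
have Cm : C Wm by apply: (chain_closed_union Cideal Ctotal Cmax) => //; exists [set 0].
have Cp : C Wp by apply: (chain_bigcap Cideal Ctotal Cmax) => // W [].
have sm : small Wm := closed_union_small.
have lp : ~ small Wp.
  apply: bigcap_large; exists setT; split; first exact: (chain_setT Cideal Ctotal Cmax).
  by move=> /(_ x xN) h; apply: nYx; exact: h.
have dich W : C W -> W `<=` Wm \/ Wp `<=` W.
  move=> CW; have [sW|lW] := pselect (small W).
    by left; apply: sub_closed_union.
  by right => y; apply.
have mp : Wm `<=` Wp.
  have [//|pm] := Ctotal Cm Cp.
  by case: lp => y yN [y1 y2]; apply: sm => //; split; exact: pm.
have [iWm _] := Cideal Cm; have [iWp _] := Cideal Cp.
have cWp := chain_subspace Cp; have cWm := chain_subspace Cm.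
have [b [b0 Wpb nWmb]] : exists b, [/\ 0 <= b, Wp b & ~ Wm b].
  apply: contrapT => H; apply: lp => y yN [y1 y2].
  have pm : Wp `<=` Wm.
    move=> w Ww; rewrite -(vpos_sub w).
    have h (u : E) : vabs u = vabs w -> Wm (vpos u).
      move=> uw; apply: contrapT => nm; apply: H; exists (vpos u); split => //.
        exact: vpos_ge0.
      apply: (ideal_le iWp (ideal_abs iWp Ww)); first exact: vpos_ge0.
      by rewrite -uw vpos_le_vabs.
    exact: (vsubB cWm (h w erefl) (h (- w) (vabsN w))).
  by apply: sm => //; split; exact: pm.
have [v [Wmv v0 vb vP]] := band_component_pos oc iWm b0.
pose a := b - v.
have a0 : 0 <= a by rewrite subv_ge0.
have Wpa : Wp a by apply: (vsubB cWp) => //; exact: mp.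
have an0 : a != 0.
  by apply/eqP => a0'; apply: nWmb; rewrite -[b](subrK v) -/a a0' add0r.
(* For a nonzero [y <= a], the subspace of the vectors of [Wp] disjoint from [y]
   contains [Wm] and misses [y]; it belongs to the chain by maximality, and
   therefore lies below [Wm]. *)
have between y w : Wp w -> 0 <= y -> y <= a -> disjoint_vect w y -> ~ disjoint_vect y y ->
    Wp y -> Wm w /\ C (Wp `&` perp y) /\ Wp `&` perp y `<=` Wm.
  move=> Ww y0 ya wy ny Wy.
  have my : Wm `<=` perp y.
    move=> u Wu; apply/disjointC; apply: (disjoint_le (y := a)); last exact: vP.
    by rewrite !vabs_id.
  have CU : C (Wp `&` perp y).
    have [cPs _] := perp_closed_ideal y.
    apply: (chain_comparable_in Cideal Ctotal Cmax) => //.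
      split.
      - by split; [case: cWp|case: cPs].
      - move=> c u1 u2 [u11 u12] [u21 u22]; case: cWp => _ h1 _; case: cPs => _ h2 _.
        by split; [exact: h1|exact: h2].
      - by case: cWp => _ _ h1; case: cPs => _ _ h2; exact: closedI.
    move=> V /dich[Vm|pV]; last by right => u [/pV].
    by left => u /Vm Wu; split; [exact: mp|exact: my].
  have Um : Wp `&` perp y `<=` Wm.
    by have [//|pU] := dich _ CU; have [_ yy] := pU _ Wy; case: ny.
  by split; [exact: Um|split].
have below y : 0 <= y -> y <= a -> Wp y by move=> y0 ya; exact: ideal_le iWp Wpa y0 ya.
have Aa : atom a.
  split => // y w /andP[y0 ya] /andP[w0 wa] yw.
  have [->|/eqP wn0] := eqVneq w 0; [by right|left].
  have [Wy _] : Wm y /\ C (Wp `&` perp w) /\ Wp `&` perp w `<=` Wm.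
    apply: between => //; [exact: below| |exact: below].
    by move=> /disjoint_self.
  apply: disjoint_self; apply: (disjoint_le (y := a)); first by rewrite !vabs_id.
  exact: vP.
have [_ [CU Um]] : Wm 0 /\ C (Wp `&` perp a) /\ Wp `&` perp a `<=` Wm.
  apply: between => //; [by case: cWp|exact: disjoint0|].
  by move=> /disjoint_self/eqP; rewrite (negbTE an0).
have [d [c [Ad c0 ad]]] := atom_representative Aa.
have Aad := A_atom Ad.
have da : perp d = perp a.
  apply/seteqP; split => u du; apply/disjointC.
    by rewrite ad; apply: disjointZ; exact/disjointC.
  rewrite -[d](scalerK c0) -ad; apply: disjointZ; exact/disjointC.
have Wpd : Wp d by rewrite -[d](scalerK c0) -ad; exact: (vsubZ _ cWp).
rewrite -da in CU Um.
have dP := riesz_proj_diagonal Cp Wpd Aad CU.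
have YPd : Y (P (catom d)).
  move: dP; have [dz _|dz d0] := eqVneq (diagonal_entry T d)%:C z; first exact: YA.
  apply: sm; first exact: P_in.
  have [[h1 h2] _] := riesz_proj_chain Cp (catom_cset cWp Wpd).
  have [k1 k2] := (ccoordinate_eq0 Aad _).1 d0.
  by split; apply: Um; split.
apply: lp => y yN Wy.
pose u : EC := y - ccoordinate d y *: catom d.
have Wu : cset Wm u.
  have sWp := cset_subspace cWp.
  have [u1 u2] : cset Wp u.
    by apply: sub_sub => //; apply: sub_scale => //; exact: catom_cset.
  have [k1 k2] : cset (perp d) u.
    apply/(ccoordinate_eq0 Aad).
    by rewrite ccoordinateB// ccoordinateZ// ccoordinate_catom// mulr1 subrr.
  by split; apply: Um; split.
have -> : y = ccoordinate d y *: P (catom d) + P u.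
  by rewrite -linearZ_LR -linearD addrC subrK ker_in.
apply: sY.2 => //; apply: sm; first exact: P_in.
by have [] := riesz_proj_chain Cm Wu.
Qed.

End spanning.

Lemma multiplicity_diagonal_atoms : exists m : nat,
  [/\ has_rank P m, diagonal_atoms #= `I_m & spectrum S z <-> m != 0%N].
Proof.
have [m Fm] := (finite_setP _).1 finite_diagonal_atoms; exists m.
have /card_set_bijP[f [fF finj fsurj]] : `I_m #= diagonal_atoms by rewrite card_eq_sym.
have {}finj i j : (i < m)%N -> (j < m)%N -> f i = f j -> i = j.
  by move=> im jm; apply: finj; rewrite inE.
pose e i : EC := P (catom (f i)).
have eN i : iter p L (e i) = 0 by exact: P_in.
have free := riesz_proj_atoms_free (m := m) fF finj.
have [sY cY] := span_below_closed_subspace e m.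
have spanE : range P = span_below e m.
  rewrite (range_riesz_proj fp); apply/seteqP; split => [x xN|_ [c ->]].
    apply: (riesz_proj_atoms_span sY cY _ xN) => a /fsurj[i im <-].
    exact: span_below_mem.
  rewrite /= linear_sum big1// => i _; rewrite linearZ_LR /=.
  by rewrite eN scaler0.
split => //.
- exists (fun i : 'I_m => e i); split.
    move=> c sum0 i; pose d (j : nat) : R[i] := if insub j is Some k then c k else 0.
    have dE (k : 'I_m) : d k = c k by rewrite /d valK.
    rewrite -dE; apply: free => //; rewrite -[RHS]sum0.
    by apply: eq_bigr => k _; rewrite dE.
  rewrite spanE; apply/seteqP; split => [_ [c ->]|_ [c _ <-]].
    by exists (fun i : 'I_m => c i).
  exists (fun j => if insub j is Some k then c k else 0).
  by apply: eq_bigr => k _; rewrite valK.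
split => [Sz|m0]; last first.
  case: m m0 {Fm spanE sY cY} free fF finj fsurj => // m _ free fF _ _.
  move=> [U [_ LU _]].
  have e0 : e 0%N = 0.
    have L0 : L (0 : EC) = 0 by rewrite linear0.
    have Linj (x : EC) : L x = 0 -> x = 0.
      by move=> Lx; rewrite -[x]LU -[X in U X]/(L x) Lx -[RHS]LU -[X in _ = U X]/(L 0) L0.
    have : iter p L (e 0%N) = 0 by exact: P_in.
    by elim: (p) => // k IH /Linj.
  suff sum0 : \sum_(i < m.+1) (val i == 0%N)%:R *: e i = 0.
    have := free (fun j => (j == 0%N)%:R) sum0 0%N (ltn0Sn m).
    by move/eqP; rewrite oner_eq0.
  rewrite big_ord_recl /= -/(e 0%N) e0 scaler0 add0r big1// => i _.
  by rewrite scale0r.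
apply/negP => /eqP m0; apply: Sz.
apply: (char_op_injective_inverse cS (Sr z0)) => x Lx.
have xN : iter p L x = 0.
  by apply: (ker_stable fp (q := 1)).
have : span_below e m x by rewrite -spanE (range_riesz_proj fp).
by move=> [c ->]; rewrite m0 big_ord0.
Qed.

End ringrose.

Theorem theorem3p9 (R : realType) (E : banachLatticeType R)
    (T : {linear E -> E}) (A : set E) :
  continuous T ->
  order_continuous_norm E ->
  ideal_triangularizable T ->
  riesz_operator (complexify T) ->
  maximal_nonequivalent_atoms A ->
  spectrum (complexify T) `\ 0 =
    [set (diagonal_entry T a)%:C | a in A] `\ 0 /\
  (forall lambda, spectrum (complexify T) lambda -> lambda != 0 ->
    exists m : nat, algebraic_multiplicity (complexify T) lambda m /\
      [set a | A a /\ (diagonal_entry T a)%:C = lambda] #= `I_m).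
Proof.
move=> _ oc [C [Cideal Ctotal Cmax]] Srz maxA.
have main z : z != 0 -> exists m : nat,
    [/\ algebraic_multiplicity (complexify T) z m,
        diagonal_atoms T A z #= `I_m & spectrum (complexify T) z <-> m != 0%N].
  move=> z0.
  have cS : continuous (complexify T : {linear complexification E -> complexification E}).
    exact: Srz.1.2.
  have Sr w : w != 0 -> riesz_at (complexify T) w.
    exact: (@riesz_operator_riesz_at R (complexification E) (complexify T) w Srz).
  have [p fp] := fitting_exponent_ex cS (Sr z z0).
  have [m [rk card spec]] :=
    multiplicity_diagonal_atoms oc Srz maxA Cideal Ctotal Cmax z0 fp.
  exists m; split => //; exists (riesz_proj_fun fp); split => //.
  exact: (riesz_proj_spectral cS Sr z0).
split; last first.
  by move=> z _ /main[m [mult card _]]; exists m.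
apply/seteqP; split => [z [Sz /eqP z0]|_ [[a Aa <-] /eqP z0]]; split => //.
- have [m [_ card [/(_ Sz) m0 _]]] := main z z0.
  have /card_set_bijP[f [fF _ _]] : `I_m #= diagonal_atoms T A z by rewrite card_eq_sym.
  have [|Aa az] := fF 0%N; first by rewrite /= lt0n.
  by exists (f 0%N).
- exact/eqP.
- have [m [_ card [_]]] := main _ z0; apply; apply/eqP => m0.
  move: card; rewrite m0 II0 card_eq0 => /eqP F0.
  have : diagonal_atoms T A (diagonal_entry T a)%:C a by [].
  by rewrite F0.
- exact/eqP.
Qed.
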